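(* Let $\mathrm{EF}(c)=\{p(\cdot,\theta):\theta\in\Theta\}$ be an exponential family with expectation parameters $\eta(\theta)=E_\theta[c]$. The Kullback-Leibler projection of the Fokker-Planck solution $p_t$ onto $\mathrm{EF}(c)$ has expectation parameters $\eta_t=E_{p_t}[c]$, evolving according to $\frac{d}{dt}\eta_t=E_{p_t}[\mathcal L_tc]$. Close this equation by replacing $p_t$ on the right-hand side with the density of $\mathrm{EF}(c)$ having expectation parameters equal to the current value, i.e. consider $$\frac{d}{dt}\tilde\eta_t=E_{p(\cdot;\tilde\eta_t)}[\mathcal L_tc],\qquad(\ast)$$ where $p(\cdot;\eta)$ denotes the density of $\mathrm{EF}(c)$ with $c$-expectations equal to $\eta$ (assumed density approximation). Then this approximation is equivalent to the one based on the vector field projection in the Fisher metric. That is, for a continuously differentiable curve $t\mapsto\theta_t\in\Theta$ with $\tilde\eta_t=\eta(\theta_t)$, the curve $\tilde\eta_t$ satisfies $(\ast)$ if and only if $p(\cdot,\theta_t)$ follows the projected Fokker-Planck vector field, $$\frac{d}{dt}\log p(\cdot,\theta_t)=\Pi_{\theta_t}\!\left[\frac{\mathcal L_t^*p(\cdot,\theta_t)}{p(\cdot,\theta_t)}\right],$$ equivalently, if and only if $$\dot\theta_t=g^{-1}(\theta_t)\,E_{\theta_t}[\mathcal L_tc].$$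
   Context: Diffusion. $X$ solves the Itô SDE $dX_t=f_t(X_t)\,dt+\sigma_t(X_t)\,dW_t$ in $\mathbb R^N$, with $W$ an $M$-dimensional standard Brownian motion, $f_t$ an $N$-vector, $\sigma_t$ an $N\times M$ matrix, $a_t=\sigma_t\sigma_t'$. Assumptions: (A) $X_0$ is independent of $W$ and has an almost everywhere positive Lebesgue density $p_0$ with finite moments of every order. (B) $f$ is once continuously differentiable in $x$ and continuous in $t$; $a$ is twice continuously differentiable in $x$ and continuous in $t$. (C) There is $K>0$ with $2x'f_t(x)+\|a_t(x)\|\le K(1+|x|^2)$ for all $t\ge0$, $x\in\mathbb R^N$. (D) $X_t$ has a density $p_t(x)$ which is $C^{2}$ in $x$ and $C^1$ in $t$, is positive for all $t\ge 0$ and almost all $x$, and satisfies the Fokker-Planck equation $\partial_t p_t=\mathcal L_t^*p_t$. Operators: $\mathcal L_t=\sum_i f_i\,\partial_{x_i}+\frac12\sum_{i,j}a_{ij}\,\partial^2_{x_ix_j}$, and $\mathcal L_t^*p=-\sum_i\partial_{x_i}(f_ip)+\frac12\sum_{i,j}\partial^2_{x_ix_j}(a_{ij}p)$ (time arguments of $f$, $a$ suppressed). Operators and integrals are applied componentwise to vector functions. Exponential family. $c=(c_1,\dots,c_n)$, $c_i:\mathbb R^N\to\mathbb R$, $p(x,\theta)=\exp(\theta^Tc(x)-\psi(\theta))$ is a probability density with respect to Lebesgue measure for $\theta\in\Theta$, where $\Theta\subset\mathbb R^n$ is a maximal convex open set. $E_\theta$ is expectation under $p(\cdot,\theta)$,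 and $g(\theta)=[\mathrm{Cov}_{p(\cdot,\theta)}(c_i,c_j)]_{ij}=\mathrm{Hess}\,\psi(\theta)$ is the Fisher information matrix, assumed invertible, with inverse $[g^{ij}(\theta)]$. (E) $c\in C^2$. (F) $E_\theta\big[\big(\mathcal L_t^*p(\cdot,\theta)/p(\cdot,\theta)\big)^2\big]<\infty$ for all $\theta\in\Theta$, $t\ge0$. Projection. For $U$ with $E_\theta[U]=0$, $E_\theta[U^2]<\infty$, $$\Pi_\theta U=\sum_{i,j=1}^n g^{ij}(\theta)\,\mathrm{Cov}_{p(\cdot,\theta)}(U,c_i)\,(c_j-E_\theta c_j),$$ the $L^2(p(\cdot,\theta))$-orthogonal projection onto the tangent space $\mathrm{span}\{c_j-E_\theta c_j:j=1,\dots,n\}$. Duality convention. $\mathcal L_t^*$ is the dual of $\mathcal L_t$ in the sense that, for $p=p(\cdot,\theta)$ and $p=p_t$, the integrals are finite and $\int c_i\,\mathcal L_t^*p\,dx=\int p\,\mathcal L_tc_i\,dx$, $\int\mathcal L_t^*p\,dx=0$; and $\frac{d}{dt}E_{p_t}[c]=\int c\,\partial_tp_t\,dx$. The Kullback-Leibler projection of $p_t$ onto $\mathrm{EF}(c)$ is the density of $\mathrm{EF}(c)$ minimizing $D(p_t\|\cdot)=\int p_t\log\frac{p_t}{\cdot}\,dx$; it is characterized by matching the $c$-expectations of $p_t$. *)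

(* Defs.v *)
From HB Require Import structures.
From mathcomp Require Import all_boot all_order all_algebra.
From mathcomp Require Import all_classical all_reals all_analysis.

Set Implicit Arguments.
Unset Strict Implicit.
Unset Printing Implicit Defensive.

Import Order.TTheory GRing.Theory Num.Theory.
Import numFieldNormedType.Exports.

Local Open Scope classical_set_scope.
Local Open Scope ring_scope.

Notation realm R := (measurableTypeR R).

Section leb_cons.
Context {R : realType} (n : nat).
Variable m : {sigma_finite_measure set (n.-tuple (realm R)) -> \bar R}.

Definition tcons (z : realm R * n.-tuple (realm R)) : n.+1.-tuple (realm R) :=
  [the n.+1.-tuple (realm R) of z.1 :: z.2].

Definition tuncons (x : n.+1.-tuple (realm R)) : realm R * n.-tuple (realm R) :=
  (thead x, [tuple of behead x]).

Lemma measurable_tcons : measurable_fun setT tcons.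
Proof. exact: measurable_cons. Qed.

Lemma measurable_tuncons : measurable_fun setT tuncons.
Proof.
apply/measurable_fun_pairP; split; last exact: measurable_behead.
exact: (measurable_tnth ord0).
Qed.

Lemma tconsK : cancel tcons tuncons.
Proof. by case=> x y; congr pair; apply: val_inj. Qed.

Definition leb_cons : set (n.+1.-tuple (realm R)) -> \bar R :=
  pushforward (@lebesgue_measure R \x m)%E tcons.

Let leb_cons0 : leb_cons set0 = 0%E.
Proof. by rewrite /leb_cons /pushforward preimage_set0 measure0. Qed.

Let leb_cons_ge0 A : (0 <= leb_cons A)%E.
Proof. by rewrite /leb_cons /pushforward measure_ge0. Qed.

Let leb_cons_sigma_additive : semi_sigma_additive leb_cons.
Proof.
move=> F mF tF mUF; rewrite /leb_cons /pushforward preimage_bigcup.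
apply: measure_semi_sigma_additive.
- by move=> k; rewrite -[X in measurable X]setTI; exact: measurable_tcons.
- apply/trivIsetP => /= i j _ _ ij; rewrite -preimage_setI.
  by move/trivIsetP : tF => /(_ _ _ _ _ ij) ->//; rewrite preimage_set0.
- by rewrite -preimage_bigcup -[X in measurable X]setTI; exact: measurable_tcons.
Qed.

HB.instance Definition _ := isMeasure.Build _ _ _ leb_cons
  leb_cons0 leb_cons_ge0 leb_cons_sigma_additive.

Let leb_cons_sigma_finite : sigma_finite setT leb_cons.
Proof.
have /sigma_finiteP[F [TF ndF Foo]] := sigma_finiteT (@lebesgue_measure R).
have /sigma_finiteP[G [TG ndG Goo]] := sigma_finiteT m.
exists (fun k => tuncons @^-1` (F k `*` G k)).
  apply/seteqP; split => // x _.
  have [k _ Fk] : (\bigcup_i F i) (tuncons x).1 by rewrite -TF.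
  have [l _ Gl] : (\bigcup_i G i) (tuncons x).2 by rewrite -TG.
  exists (maxn k l) => //; split.
    by move: Fk; exact/subsetPset/ndF/leq_maxl.
  by move: Gl; exact/subsetPset/ndG/leq_maxr.
move=> k; have [mF F_fin] := Foo k; have [mG G_fin] := Goo k.
have mFG : measurable (F k `*` G k) by exact: measurableX.
split; first by rewrite -[X in measurable X]setTI; exact: measurable_tuncons.
rewrite /leb_cons /pushforward -comp_preimage.
rewrite (_ : tuncons \o _ = id) ?preimage_id; last exact/funext/tconsK.
by rewrite product_measure1E// lte_mul_pinfty// ge0_fin_numE.
Qed.

HB.instance Definition _ := Measure_isSigmaFinite.Build _ _ _ leb_cons
  leb_cons_sigma_finite.

End leb_cons.

Fixpoint lebN {R : realType} (n : nat) :
    {sigma_finite_measure set (n.-tuple (realm R)) -> \bar R} :=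
  match n with
  | 0 => [the sigma_finite_measure _ _ of dirac [tuple] ]
  | k.+1 => [the sigma_finite_measure _ _ of leb_cons (lebN k)]
  end.

Lemma leb_box {R : realType} (n : nat) (A : 'I_n -> set (realm R)) :
  (forall i, measurable (A i)) ->
  lebN n [set x | forall i, A i (tnth x i)] =
  (\prod_(i < n) @lebesgue_measure R (A i))%E.
Proof.
elim: n A => [|n IH] A mA /=.
  by rewrite big_ord0 diracE mem_set// => -[].
rewrite big_ord_recl -IH; last by move=> i; exact: mA.
rewrite -product_measure1E//; last first.
  rewrite (_ : [set x | _] =
      \bigcap_(i in [set: 'I_n]) ((@tnth n (realm R))^~ i @^-1` A (lift ord0 i))).
    apply: fin_bigcap_measurable => //.
    by move=> i _; rewrite -[X in measurable X]setTI; exact: measurable_tnth.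
  by apply/seteqP; split => x /= H i; [move=> _|]; exact: H.
rewrite /leb_cons /pushforward; congr (_ _); apply/seteqP; split => -[x y] /=.
  move=> H; split; first exact: (H ord0).
  by move=> i; have := H (lift ord0 i); rewrite tnthS.
move=> [Hx Hy] i; case: (unliftP ord0 i) => [j ->|->] //.
by rewrite tnthS; exact: Hy.
Qed.

Section calculus.
Context {R : realType}.

Definition nonneg : set R := [set t | 0 <= t].

(* g has derivative l at t relative to J: two-sided in the interior of the
   interval J, one-sided at those of its endpoints that belong to J *)
Definition is_deriv_on {V : normedModType R} (J : set R) (g : R -> V) (t : R)
    (l : V) : Prop :=
  (s - t)^-1 *: (g s - g t) @[s --> within J t^'] --> l.

Definition deriv_on {V : normedModType R} (J : set R) (g : R -> V) (t : R) : V :=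
  lim ((s - t)^-1 *: (g s - g t) @[s --> within J t^']).

Definition C1_on {V : normedModType R} (J : set R) (g : R -> V) : Prop :=
  exists2 dg : R -> V, forall t, J t -> is_deriv_on J g t (dg t) &
                       {within J, continuous dg}.

Definition nondegenerate_interval (J : set R) : Prop :=
  is_interval J /\ exists s t, [/\ J s, J t & s < t].

Context {N : nat}.

Definition partial (i : 'I_N) (h : 'cV[R]_N -> R) (x : 'cV[R]_N) : R :=
  'D_(delta_mx i 0) h x.

Fixpoint Ck (k : nat) (h : 'cV[R]_N -> R) : Prop :=
  continuous h /\
  match k with
  | 0 => True
  | l.+1 => forall i, (forall x, derivable h x (delta_mx i 0)) /\
                      Ck l (partial i h)
  end.

Definition generator (f : 'cV[R]_N -> 'cV[R]_N) (a : 'cV[R]_N -> 'M[R]_N)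
    (h : 'cV[R]_N -> R) (x : 'cV[R]_N) : R :=
  \sum_i f x i 0 * partial i h x +
  2^-1 * \sum_i \sum_j a x i j * partial i (partial j h) x.

Definition fokker_planck (f : 'cV[R]_N -> 'cV[R]_N) (a : 'cV[R]_N -> 'M[R]_N)
    (q : 'cV[R]_N -> R) (x : 'cV[R]_N) : R :=
  - (\sum_i partial i (fun y => f y i 0 * q y) x) +
  2^-1 * \sum_i \sum_j partial i (partial j (fun y => a y i j * q y)) x.

Definition generator_vec n (f : 'cV[R]_N -> 'cV[R]_N) (a : 'cV[R]_N -> 'M[R]_N)
    (c : 'cV[R]_N -> 'cV[R]_n) (x : 'cV[R]_N) : 'cV[R]_n :=
  \col_k generator f a (fun y => c y k 0) x.

End calculus.

(* The norm `|x| of the library on matrices is the maximum of the entries. *)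
Definition norm2 {R : realType} {N : nat} (x : 'cV[R]_N) : R :=
  Num.sqrt (\sum_i x i 0 ^+ 2).

Definition opnorm {R : realType} {N M : nat} (A : 'M[R]_(N, M)) : R :=
  sup [set norm2 (A *m v) | v in [set v : 'cV[R]_M | norm2 v <= 1]].

Section integration.
Context {R : realType} {N : nat}.

(* Lebesgue measure lives on N.-tuple R, which carries the product sigma-algebra,
   while calculus takes place in 'cV[R]_N; vec and tup identify the two. *)
Definition vec (x : N.-tuple (realm R)) : 'cV[R]_N := \col_i (tnth x i : R).

Definition tup (v : 'cV[R]_N) : N.-tuple (realm R) :=
  [tuple (v i 0 : realm R) | i < N].

Definition leb_integrable (h : 'cV[R]_N -> R) : Prop :=
  (@lebN R N).-integrable setT (fun x => (h (vec x))%:E).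

(* integral of h with respect to Lebesgue measure; for non-negative h the
   extended version integ_ext is meaningful without integrability *)
Definition integ (h : 'cV[R]_N -> R) : R := \int[@lebN R N]_x h (vec x).

Definition integ_ext (h : 'cV[R]_N -> R) : \bar R :=
  (\int[@lebN R N]_x (h (vec x))%:E)%E.

Definition expect (q h : 'cV[R]_N -> R) : R := integ (fun x => h x * q x).

Definition expect_vec n (q : 'cV[R]_N -> R) (h : 'cV[R]_N -> 'cV[R]_n) : 'cV[R]_n :=
  \col_k expect q (fun x => h x k 0).

Definition cov (q U V : 'cV[R]_N -> R) : R :=
  expect q (fun x => (U x - expect q U) * (V x - expect q V)).

Definition KL (q r : 'cV[R]_N -> R) : \bar R :=
  integ_ext (fun x => q x * ln (q x / r x)).

Definition dual_pair n (f : 'cV[R]_N -> 'cV[R]_N) (a : 'cV[R]_N -> 'M[R]_N)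
    (c : 'cV[R]_N -> 'cV[R]_n) (q : 'cV[R]_N -> R) : Prop :=
  [/\ forall i : 'I_n,
        [/\ leb_integrable (fun x => c x i 0 * fokker_planck f a q x),
            leb_integrable (fun x => q x * generator f a (fun y => c y i 0) x) &
            integ (fun x => c x i 0 * fokker_planck f a q x) =
            integ (fun x => q x * generator f a (fun y => c y i 0) x)],
      leb_integrable (fokker_planck f a q) &
      integ (fokker_planck f a q) = 0].

End integration.

Section exponential_family.
Context {R : realType} {N n : nat}.
Variable c : 'cV[R]_N -> 'cV[R]_n.

Definition dotc (theta : 'cV[R]_n) (x : 'cV[R]_N) : R := (theta^T *m c x) 0 0.

Definition psi (theta : 'cV[R]_n) : R := ln (integ (fun x => expR (dotc theta x))).

Definition dens (theta : 'cV[R]_n) (x : 'cV[R]_N) : R :=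
  expR (dotc theta x - psi theta).

Definition normalizable (Theta : set 'cV[R]_n) : Prop :=
  forall theta, Theta theta -> (integ_ext (fun x => expR (dotc theta x)) < +oo)%E.

Definition parameter_space (Theta : set 'cV[R]_n) : Prop :=
  [/\ open Theta, convex_set (Theta : set (convex_lmodType 'cV[R]_n)),
      normalizable Theta &
      forall Theta' : set 'cV[R]_n, open Theta' ->
        convex_set (Theta' : set (convex_lmodType 'cV[R]_n)) ->
        normalizable Theta' -> Theta `<=` Theta' -> Theta' = Theta].

Definition expect_param (theta : 'cV[R]_n) : 'cV[R]_n := expect_vec (dens theta) c.

Definition fisher (theta : 'cV[R]_n) : 'M[R]_n :=
  \matrix_(i, j) cov (dens theta) (fun x => c x i 0) (fun x => c x j 0).

Definition tangent_proj (theta : 'cV[R]_n) (U : 'cV[R]_N -> R) (x : 'cV[R]_N) : R :=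
  \sum_i \sum_j invmx (fisher theta) i j *
    cov (dens theta) U (fun y => c y i 0) *
    (c x j 0 - expect (dens theta) (fun y => c y j 0)).

Definition EF (Theta : set 'cV[R]_n) : set ('cV[R]_N -> R) :=
  [set dens theta | theta in Theta].

(* p(.; e), the density of EF(c) with c-expectations equal to e *)
Definition dens_of_eta (Theta : set 'cV[R]_n) (e : 'cV[R]_n) : 'cV[R]_N -> R :=
  xget (fun=> 0) [set q | EF Theta q /\ expect_vec q c = e].

Definition is_KL_projection (Theta : set 'cV[R]_n) (q r : 'cV[R]_N -> R) : Prop :=
  EF Theta r /\ forall r', EF Theta r' -> (KL q r <= KL q r')%E.

End exponential_family.

Section stochastic_calculus.
Context {R : realType} {d : measure_display} {Om : measurableType d}.
Variable P : probability Om R.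

Definition filtration (F : R -> set (set Om)) : Prop :=
  (forall t, 0 <= t -> sigma_algebra setT (F t) /\ F t `<=` measurable) /\
  (forall s t, 0 <= s -> s <= t -> F s `<=` F t).

Definition measurable_wrt {m k} (G : set (set Om)) (Y : Om -> 'M[R]_(m, k)) : Prop :=
  forall i j (B : set (realm R)), measurable B ->
    G ((fun w => Y w i j) @^-1` B).

Definition adapted {m k} (F : R -> set (set Om)) (Y : R -> Om -> 'M[R]_(m, k)) : Prop :=
  forall t, 0 <= t -> measurable_wrt (F t) (Y t).

Definition continuous_paths {m k} (Y : R -> Om -> 'M[R]_(m, k)) : Prop :=
  {ae P, forall w, {within nonneg, continuous (fun t => Y t w)}}.

Definition brownian_motion {M} (F : R -> set (set Om)) (W : R -> Om -> 'cV[R]_M) :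
    Prop :=
  [/\ adapted F W, continuous_paths W, {ae P, forall w, W 0 w = 0} &
      (* W_t - W_s is independent of F_s with law N(0, (t - s) I) *)
      forall s t A (B : 'I_M -> set (realm R)), 0 <= s -> s < t -> F s A ->
        (forall i, measurable (B i)) ->
        P (A `&` [set w | forall i, B i (W t w i 0 - W s w i 0)]) =
        (P A * \prod_(i < M) normal_prob 0 (Num.sqrt (t - s)) (B i))%E].

(* sigma-algebra generated by the Y_t, t in T *)
Definition generated_by {m} (T : set R) (Y : R -> Om -> 'cV[R]_m) : set (set Om) :=
  <<s [set A | exists t i (B : set (realm R)),
        [/\ T t, measurable B & A = (fun w => Y t w i 0) @^-1` B]] >>.

Definition independent (G H : set (set Om)) : Prop :=
  forall A B, G A -> H B -> P (A `&` B) = (P A * P B)%E.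

Definition cvg_in_probability0 (Y : nat -> Om -> \bar R) : Prop :=
  forall eps : R, 0 < eps ->
    P [set w | (eps%:E < Y k w)%E] @[k --> \oo] --> 0%E.

Definition sqnorm {m k} (A : 'M[R]_(m, k)) : R := \sum_i \sum_j A i j ^+ 2.

(* a finite family of triples (s, u, xi) stands for the step process
   \sum xi 1_{]s, u]} *)
Definition step_process m k := seq (R * R * (Om -> 'M[R]_(m, k))).

Definition predictable_step {m k} (F : R -> set (set Om)) (S : step_process m k) :
    Prop :=
  forall i, (i < size S)%N ->
    let: (s, u, xi) := nth (0, 0, fun=> 0) S i in
    [/\ 0 <= s <= u, measurable_wrt (F s) xi &
        exists K : R, forall w, `|xi w| <= K].

Definition step_val {m k} (S : step_process m k) (t : R) (w : Om) : 'M[R]_(m, k) :=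
  \sum_(z <- S) if z.1.1 < t <= z.1.2 then z.2 w else 0.

Definition step_int {m k} (W : R -> Om -> 'cV[R]_k) (S : step_process m k) (t : R)
    (w : Om) : 'cV[R]_m :=
  \sum_(z <- S) z.2 w *m (W (Num.min z.1.2 t) w - W (Num.min z.1.1 t) w).

(* I_t = \int_0^t H_s dW_s: limit in probability of the integrals of step
   processes S_k with \int_0^t |H_s - S_k(s)|^2 ds --> 0 in probability *)
Definition is_ito_integral {m k} (F : R -> set (set Om)) (W : R -> Om -> 'cV[R]_k)
    (H : R -> Om -> 'M[R]_(m, k)) (I : R -> Om -> 'cV[R]_m) : Prop :=
  [/\ adapted F H, adapted F I,
      forall i j, measurable_fun ((nonneg : set (realm R)) `*` [set: Om])
        (fun z : realm R * Om => (H z.1 z.2 i j : realm R)) &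
      exists S : nat -> step_process m k,
        (forall l, predictable_step F (S l)) /\
        forall t, 0 <= t ->
          cvg_in_probability0 (fun l w =>
            \int[@lebesgue_measure R]_(s in `[0%R, t]%classic)
               (sqnorm (H s w - step_val (S l) s w))%:E)%E /\
          cvg_in_probability0 (fun l w =>
            (sqnorm (I t w - step_int W (S l) t w))%:E)].

(* dX_t = f_t(X_t) dt + sigma_t(X_t) dW_t *)
Definition ito_sde_solution {N M} (F : R -> set (set Om)) (W : R -> Om -> 'cV[R]_M)
    (f : R -> 'cV[R]_N -> 'cV[R]_N) (sigma : R -> 'cV[R]_N -> 'M[R]_(N, M))
    (X : R -> Om -> 'cV[R]_N) : Prop :=
  [/\ adapted F X, continuous_paths X &
      exists2 I : R -> Om -> 'cV[R]_N,
        is_ito_integral F W (fun t w => sigma t (X t w)) I &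
        forall t, 0 <= t -> {ae P, forall w,
          (forall i, (@lebesgue_measure R).-integrable `[0, t]%classic
                       (fun s => (f s (X s w) i 0)%:E)) /\
          X t w = X 0 w +
            (\col_i \int[@lebesgue_measure R]_(s in `[0, t]%classic) f s (X s w) i 0)
            + I t w}].

Definition has_density {N} (Y : Om -> 'cV[R]_N) (q : 'cV[R]_N -> R) : Prop :=
  [/\ forall x, 0 <= q x, measurable_fun setT (q \o vec) &
      forall A : set (N.-tuple (realm R)), measurable A ->
        P ((tup \o Y) @^-1` A) = (\int[@lebN R N]_(x in A) (q (vec x))%:E)%E].

End stochastic_calculus.

(* Main.v *)
Require Import Defs.
From HB Require Import structures.
From mathcomp Require Import all_boot all_order all_algebra.
From mathcomp Require Import all_classical all_reals all_analysis.
From mathcomp Require Import measurable_realfun ring lra.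

Set Implicit Arguments.
Unset Strict Implicit.
Unset Printing Implicit Defensive.

Import Order.TTheory GRing.Theory Num.Theory.
Import numFieldNormedType.Exports.

Local Open Scope classical_set_scope.
Local Open Scope ring_scope.

(** Write [eta th] for the expectation parameters of [dens c th], [g] for the
    Fisher matrix, and [q] for a density with finite [c]-expectations [m].

    Kullback-Leibler projection.  The log-density is affine in [th] up to the
    normalization [psi], so moving from [th] to [th'] changes the divergence
    from [q] by [psi th' - psi th - m . (th' - th)] ([KL_dens_le]).  As [psi]
    is convex with gradient [eta] ([psi_convex_ineq], [is_diff_psi]), [th] is a
    minimizer exactly when [eta th = m] ([KL_projectionP]).

    Exact moment equation.  Differentiate under the integral (an assumption of
    the theorem), insert the Fokker-Planck equation and dualize.

    Assumed density = projection.  The Jacobian of [eta] is [g]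
    ([is_diff_mean]), so along a curve in the family [eta] moves with velocity
    [g *m u], where [u] is the velocity of the parameter.  Since [g] is
    invertible, [eta] is injective ([expect_param_inj]); hence the density with
    expectation parameters [eta th] is [dens c th], and the closed moment
    equation reads [g *m u = E_th [L c]], with [L] the generator, that is
    [u = g^-1 *m E_th [L c]].
    On the other side, [d/dt ln (dens c th) = u . (c - eta)], while by duality
    the covariance of [c_i] with the relative Fokker-Planck field is
    [E_th [L c_i]] ([cov_score_dual]), so that the projected field is
    [v . (c - eta)] with [v = g^-1 *m E_th [L c]] ([tangent_projE]).  The
    functions [c_i - eta_i] are linearly independent because [g] is invertible
    ([dotc_centered_inj]), so the two fields agree exactly when [u = v].

    Regularity of [psi] and [eta].  Openness of the parameter set makes
    [exp (th . c + d |c|)] integrable for some [d > 0].  With the elementary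
    bound [|exp u - 1 - u| <= u^2 exp |u|] this controls the first order Taylor
    remainder of every integral [int w exp (th . c)] by a multiple of [|h|^2],
    so these integrals are differentiable without any exchange of limits
    ([is_diff_moment]). *)

(** * Integration over Euclidean space *)

Section integration_toolkit.
Context {R : realType} {N : nat}.
Implicit Types (g h : 'cV[R]_N -> R).

Definition leb_measurable h := measurable_fun setT (h \o @vec R N).

(** The product sigma-algebra on tuples contains the Borel sets of the normed
    space: an open set is the union of the rational cubes it contains. *)
Lemma measurable_vec_open (O : set 'cV[R]_N) :
  open O -> measurable (@vec R N @^-1` O).
Proof.
move=> oO.
pose box (z : 'cV[rat]_N * nat) := [set v : 'cV[R]_N |
  forall i, `|v i 0 - ratr (z.1 i 0)| < z.2.+1%:R^-1].
have -> : @vec R N @^-1` O = \bigcup_z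
    (if `[< box z `<=` O >] then @vec R N @^-1` box z else set0).
  apply/seteqP; split => [x /= Ox|x [z _]]; last first.
    by case: asboolP => // zO; apply: zO.
  have /nbhs_ballP[e /= e0 eO] : nbhs (vec x) O by exact: open_nbhs_nbhs.
  have [k ke] : exists k : nat, k.+1%:R^-1 < e / 2.
    exists (Num.truncn (e / 2)^-1).
    rewrite invf_plt ?posrE ?divr_gt0//.
    exact: truncnS_gt.
  have : 0 < k.+1%:R^-1 :> R by rewrite invr_gt0.
  move: ke; move Ed : (k.+1%:R^-1 : R) => d ke d0.
  have /choice[r rP] : forall i : 'I_N, exists r : rat,
      `|vec x i 0 - ratr r| < d.
    move=> i; have lt_itv : vec x i 0 - d < vec x i 0 + d.
      by lra.
    have [r] := rat_in_itvoo lt_itv.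
    rewrite in_itv /= => /andP[r1 r2]; exists r.
    by rewrite ltr_norml; apply/andP; split; lra.
  exists (\col_i r i, k) => //; case: asboolP => [_ i|]; first by rewrite /= [X in ratr X]mxE Ed; exact: rP.
  case=> v vb; apply: eO; split=> // i j.
  rewrite (ord1 j) /ball /=; have := vb i; rewrite /= [X in ratr X]mxE Ed => h2; have h1 := rP i.
  rewrite (_ : _ - _ = (vec x i 0 - ratr (r i)) - (v i 0 - ratr (r i))); last by ring.
  by rewrite (le_lt_trans (ler_normB _ _))//; lra.
apply: countable_bigcupT_measurable => //= z.
case: asboolP => // _.
rewrite (_ : _ @^-1` _ = \bigcap_(i in [set: 'I_N]) ((@tnth N (realm R))^~ i @^-1`
  (ball (ratr (z.1 i 0) : R) z.2.+1%:R^-1))).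
  apply: fin_bigcap_measurable => // i _; rewrite -[X in measurable X]setTI.
  by apply: measurable_tnth => //; exact: measurable_ball.
apply/seteqP; split => x /= H i.
  by move=> _; have := H i; rewrite /ball /= mxE distrC.
by have := H i I; rewrite /ball /= mxE distrC.
Qed.

Lemma continuous_leb_measurable h : continuous h -> leb_measurable h.
Proof.
move=> /continuousP ch; apply: (measurability _ (RGenOpens.measurableE R)).
move=> _ [_ [a [b ->] <-]]; rewrite setTI comp_preimage.
by apply: measurable_vec_open; exact/ch/interval_open.
Qed.

Lemma leb_integrable_measurable h : leb_integrable h -> leb_measurable h.
Proof. by move=> /measurable_int/measurable_EFinP. Qed.

Lemma leb_measurableM g h :
  leb_measurable g -> leb_measurable h -> leb_measurable (fun x => g x * h x).
Proof. exact: measurable_funM. Qed.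

Lemma leb_integrable_le g h : leb_measurable h ->
  (forall x, `|h x| <= g x) -> leb_integrable g -> leb_integrable h.
Proof.
move=> mh hg; apply: le_integrable => //; first exact/measurable_EFinP.
move=> x _ /=; rewrite lee_fin; apply: le_trans (hg _) _; exact: ler_norm.
Qed.

Lemma leb_integrableD g h : leb_integrable g -> leb_integrable h ->
  leb_integrable (fun x => g x + h x).
Proof. by move=> ig ih; exact: (integrableD measurableT ig ih). Qed.

Lemma leb_integrableB g h : leb_integrable g -> leb_integrable h ->
  leb_integrable (fun x => g x - h x).
Proof. by move=> ig ih; exact: (integrableB measurableT ig ih). Qed.

Lemma leb_integrableZ k h : leb_integrable h ->
  leb_integrable (fun x => k * h x).
Proof. by move=> ih; exact: (integrableZl measurableT k ih). Qed.

Lemma leb_integrable_sum n (h : 'I_n -> 'cV[R]_N -> R) :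
  (forall i, leb_integrable (h i)) -> leb_integrable (fun x => \sum_i h i x).
Proof.
move=> ih; apply: eq_integrable (integrable_sum measurableT (index_enum 'I_n)
  (P := xpredT) (fun i _ => ih i)) => // x _.
by rewrite /= sumEFin.
Qed.

Lemma integD g h : leb_integrable g -> leb_integrable h ->
  integ (fun x => g x + h x) = integ g + integ h.
Proof. by move=> ig ih; apply: RintegralD. Qed.

Lemma integB g h : leb_integrable g -> leb_integrable h ->
  integ (fun x => g x - h x) = integ g - integ h.
Proof. by move=> ig ih; apply: RintegralB. Qed.

Lemma integZ k h : leb_integrable h ->
  integ (fun x => k * h x) = k * integ h.
Proof. by move=> ih; apply: RintegralZl. Qed.

Lemma integ0 : integ (fun _ : 'cV[R]_N => 0) = 0.
Proof. by rewrite /integ /Rintegral integral0. Qed.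

Lemma leb_integrable0 : leb_integrable (fun _ : 'cV[R]_N => 0).
Proof. exact: integrable0. Qed.

Lemma integ_sum n (h : 'I_n -> 'cV[R]_N -> R) :
  (forall i, leb_integrable (h i)) ->
  integ (fun x => \sum_i h i x) = \sum_i integ (h i).
Proof.
elim: n h => [|n IH] h ih.
  by rewrite big_ord0 -[RHS]integ0; congr integ; apply/funext => x; rewrite big_ord0.
rewrite big_ord_recl -IH; last by move=> i; exact: ih.
rewrite -integD//; first by congr integ; apply/funext => x; rewrite big_ord_recl.
by apply: leb_integrable_sum => i; exact: ih.
Qed.

Lemma le_integ g h : leb_integrable g -> leb_integrable h ->
  (forall x, g x <= h x) -> integ g <= integ h.
Proof. by move=> ig ih gh; apply: le_Rintegral. Qed.

Lemma le_norm_integ g h : leb_measurable h ->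
  (forall x, `|h x| <= g x) -> leb_integrable g -> `|integ h| <= integ g.
Proof.
move=> mh hg ig; have ih := leb_integrable_le mh hg ig.
apply: le_trans (le_normr_Rintegral measurableT ih) _.
apply: le_Rintegral => //; exact: integrable_norm.
Qed.

Lemma integ_ge0 h : (forall x, 0 <= h x) -> 0 <= integ h.
Proof. by move=> h0; apply: Rintegral_ge0. Qed.

Lemma integ_extE h : leb_integrable h -> integ_ext h = (integ h)%:E.
Proof. by move=> ih; rewrite /integ /Rintegral fineK//; exact: integrable_fin_num. Qed.

(** Turns the hypotheses that are stated by means of extended integrals into
    integrability. *)
Lemma ge0_leb_integrableP h : leb_measurable h -> (forall x, 0 <= h x) ->
  leb_integrable h <-> (integ_ext h < +oo)%E.
Proof.
move=> mh h0; split=> [ih|hoo]; first by rewrite integ_extE// ltry.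
apply/integrableP; split; first exact/measurable_EFinP.
by under eq_integral do rewrite /= ger0_norm//.
Qed.

(** How almost everywhere statements are used here: if [h >= 0] has integral
    zero, then [h], and with it any function vanishing on its zero set, is
    negligible. *)
Lemma integ_eq0_supp g h : leb_integrable h -> (forall x, 0 <= h x) ->
  integ h = 0 -> leb_measurable g -> (forall x, h x = 0 -> g x = 0) ->
  integ g = 0.
Proof.
move=> ih h0 Ih0 mg hg; have mh := leb_integrable_measurable ih.
have : (\int[@lebN R N]_x `|(h (vec x))%:E| = 0)%E.
  under eq_integral do rewrite gee0_abs ?lee_fin//.
  by have := integ_extE ih; rewrite Ih0.
move=> /(ae_eq_integral_abs _ measurableT (proj2 (measurable_EFinP _ _) mh)) h0ae.
rewrite /integ /Rintegral (ae_eq_integral (cst 0%E))// ?integral0//.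
  exact/measurable_EFinP.
by apply: filterS h0ae => x /(_ I) /= [hx] _; rewrite (hg _ hx).
Qed.

(** If the integral were zero, the unit cube, whose measure is 1, would be
    negligible. *)
Lemma integ_gt0 h : leb_integrable h -> (forall x, 0 < h x) -> 0 < integ h.
Proof.
move=> ih h0; rewrite lt_neqAle integ_ge0 ?andbT; last by move=> x; exact: ltW.
apply/eqP => /esym Ih0.
pose A := [set x : N.-tuple (realm R) | forall i : 'I_N, `[0, 1]%classic (tnth x i : R)].
have mA : measurable A.
  rewrite (_ : A = \bigcap_(i in [set: 'I_N]) ((@tnth N (realm R))^~ i @^-1` `[0, 1]%classic)).
    apply: fin_bigcap_measurable => // i _; rewrite -[X in measurable X]setTI.
    by apply: measurable_tnth => //; exact: measurable_itv.
  by apply/seteqP; split => x /= H i; [move=> _|]; exact: H.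
pose g (v : 'cV[R]_N) : R := \1_A (tup v).
have tupK : forall x : N.-tuple (realm R), tup (vec x) = x.
  by move=> x; apply: eq_from_tnth => i; rewrite tnth_mktuple mxE.
have gE : g \o @vec R N = \1_A by apply/funext => x; rewrite /g /= tupK.
have : integ g = 0.
  apply: (integ_eq0_supp ih _ Ih0) => [x|//|x hx0]; first exact: ltW.
    by rewrite /leb_measurable gE; exact: measurable_indic.
  by have := h0 x; rewrite hx0 ltxx.
rewrite /integ; under eq_Rintegral do rewrite /g tupK.
rewrite /Rintegral integral_indic// setIT.
rewrite [X in fine X](_ : _ = 1%E); first by move/eqP; rewrite oner_eq0.
apply: etrans (leb_box (fun=> measurable_itv `[0, 1])) _.
by rewrite big1// => i _; rewrite lebesgue_measure_itv /= lte_fin ltr01 oppr0 adde0.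
Qed.

End integration_toolkit.

(** * Elementary estimates and differentials of linear forms *)

Section elementary_bounds.
Context {R : realType}.

(** Both factors of the bound come from [exp u - 1 <= u exp u], which gives
    [exp u - 1 - u <= u (exp u - 1)]. *)
Lemma expR_taylor1_remainder (u : R) :
  `|expR u - 1 - u| <= u ^+ 2 * expR `|u|.
Proof.
have h1 : 0 <= expR u - 1 - u by have := expR_ge1Dx u; lra.
have h2 : expR u - 1 <= u * expR u.
  have := expR_ge1Dx (- u); rewrite expRN => h.
  have e0 := expR_gt0 u.
  have : (1 - u) * expR u <= 1.
    by rewrite -ler_pdivlMr// div1r.
  lra.
rewrite ger0_norm//; apply: (@le_trans _ _ (u * (expR u - 1))); first lra.
rewrite expr2 -mulrA; have [u0|u0] := lerP 0 u.
  by rewrite ler_wpM2l// ger0_norm.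
rewrite ltr0_norm//.
have e1 : 1 <= expR (- u) by rewrite -[leLHS]expR0 ler_expR; lra.
have := expR_gt0 u; have := expR_ge1Dx u; nra.
Qed.

Lemma le_coord_norm n (v : 'cV[R]_n) k : `|v k 0| <= `|v|.
Proof.
rewrite [leRHS]/Num.norm /= mx_normrE.
by apply/bigmax_geP; right => /=; exists (k, 0).
Qed.

(** The norm is the maximum of the entries, so one of the exponentials on the
    right already dominates; the 1 covers dimension 0. *)
Lemma expR_norm_le_sum n (v : 'cV[R]_n) (d : R) : 0 <= d ->
  expR (d * `|v|) <= 1 + \sum_k (expR (d * v k 0) + expR (- (d * v k 0))).
Proof.
move=> d0.
have s0 (P : pred 'I_n) : 0 <= \sum_(k | P k) (expR (d * v k 0) + expR (- (d * v k 0))).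
  by apply: sumr_ge0 => k _; rewrite addr_ge0// expR_ge0.
have [->|v0] := eqVneq (`|v|) 0; first by rewrite mulr0 expR0 lerDl.
have [[k j] /= vk] : exists i, mx_norm v = `|v i.1 i.2|.
  by apply: mx_norm_neq0; rewrite -[mx_norm v]/(`|v|); apply: contra_neqN v0 => /eqP.
rewrite {1}[`|v|]vk (ord1 j) (bigD1 k)//= addrCA.
apply: (@le_trans _ _ (expR (d * v k 0) + expR (- (d * v k 0)))).
  have [vk0|vk0] := lerP 0 (v k 0); first by rewrite (ger0_norm vk0) lerDl expR_ge0.
  by rewrite (ltr0_norm vk0) mulrN lerDr expR_ge0.
by rewrite lerDl addr_ge0.
Qed.

End elementary_bounds.

Lemma cvg_sum_ord {R : realType} {T : Type} (F : set_system T) {FF : Filter F} n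
    (f : 'I_n -> T -> R) (l : 'I_n -> R) :
  (forall i, f i x @[x --> F] --> l i) ->
  \sum_i f i x @[x --> F] --> \sum_i l i.
Proof.
elim: n f l => [|n IH] f l fl.
  by rewrite big_ord0; under eq_fun do rewrite big_ord0; exact: cvg_cst.
rewrite big_ord_recl; under eq_fun do rewrite big_ord_recl.
by apply: cvgD => //; apply: IH => i; exact: fl.
Qed.

(** Differentiability from an explicit candidate for the differential, in the
    epsilon form in which the remainder estimates below are obtained. *)
Lemma is_diff_remainder {R : numFieldType} (V W : normedModType R) (f : V -> W)
    (df : {linear V -> W}) (x : V) : continuous df ->
  (forall e, 0 < e -> \forall h \near 0, `|f (h + x) - f x - df h| <= e * `|h|) ->
  is_diff x f df.
Proof.
move=> cdf fdf.
have fo : f \o shift x = cst (f x) + df +o_ 0 id.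
  apply/eqaddoP => e e0; apply: filterS (fdf e e0) => h.
  by rewrite /= !fctE opprD addrA.
have dfE := diff_unique cdf fo.
by split=> //; apply/diff_locallyP; rewrite dfE.
Qed.

Section linear_form.
Context {R : realType} {n : nat}.

Definition linear_form (L : 'I_n -> R) (h : 'cV[R]_n) : R := \sum_k h k 0 * L k.

Lemma linear_form_is_linear L : linear (linear_form L).
Proof.
move=> a u v; rewrite /linear_form scaler_sumr -big_split/=.
by apply: eq_bigr => k _; rewrite !mxE mulrDl scalerAl.
Qed.

HB.instance Definition _ L :=
  GRing.isLinear.Build R 'cV[R]_n R _ (linear_form L) (linear_form_is_linear L).

Lemma linear_form_continuous L : continuous (linear_form L).
Proof.
move=> h; apply: (@cvg_sum_ord R _ (nbhs h) (nbhs_filter h) n (fun k v => v k 0 * L k)) => k.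
by apply: cvgMl; exact: coord_continuous.
Qed.

Lemma is_diff_quadratic (F : 'cV[R]_n -> R) (th : 'cV[R]_n) L (K d : R) :
  0 < d ->
  (forall h : 'cV[R]_n, `|h| <= d -> `|F (h + th) - F th - linear_form L h| <= K * `|h| ^+ 2) ->
  is_diff th F (linear_form L).
Proof.
move=> d0 FK.
apply: is_diff_remainder; first exact: linear_form_continuous.
move=> e e0; near=> h.
have K0 : 0 < `|K| + 1 by rewrite ltr_pwDr.
have hd : `|h| <= d.
  by near: h; apply/nbhs_ballP; exists d => //= y; rewrite -ball_normE /= sub0r normrN => /ltW.
apply: le_trans (FK _ hd) _.
rewrite expr2 mulrA ler_wpM2r//.
apply: (@le_trans _ _ ((`|K| + 1) * `|h|)).
  by rewrite ler_wpM2r//; have := ler_norm K; lra.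
rewrite mulrC -ler_pdivlMr//.
near: h; apply/nbhs_ballP; exists (e / (`|K| + 1)) => /=; first by rewrite divr_gt0.
by move=> y; rewrite -ball_normE /= sub0r normrN => /ltW.
Unshelve. all: by end_near. Qed.

End linear_form.

(** * Differentiability of exponential moments *)

Lemma cvg_cV {R : realType} {T : Type} (F : set_system T) {FF : Filter F} n
    (f : T -> 'cV[R]_n) (l : 'cV[R]_n) :
  (forall k, f x k 0 @[x --> F] --> l k 0) -> f x @[x --> F] --> l.
Proof.
move=> fl; apply/cvg_ballP => e e0.
have : \forall x \near F, forall k : 'I_n, ball (l k 0) e (f x k 0).
  by apply: filter_forall => k; exact: (cvg_ball (fl k)).
by apply: filterS => x H; split=> // i j; rewrite (ord1 j); exact: H.
Qed.

Section continuous_real_functions.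
Context {R : realType} {T : topologicalType}.
Implicit Types f g : T -> R.

Lemma continuous_add f g :
  continuous f -> continuous g -> continuous (fun x => f x + g x).
Proof. by move=> cf cg x; apply: cvgD; [exact: cf|exact: cg]. Qed.

Lemma continuous_mul f g :
  continuous f -> continuous g -> continuous (fun x => f x * g x).
Proof. by move=> cf cg x; apply: cvgM; [exact: cf|exact: cg]. Qed.

Lemma continuous_expR_comp f : continuous f -> continuous (fun x => expR (f x)).
Proof.
by move=> cf x; apply: continuous_comp; [exact: cf|exact: continuous_expR].
Qed.

Lemma continuous_scale k f : continuous f -> continuous (fun x => k * f x).
Proof. by move=> cf x; apply: cvgMr; exact: cf. Qed.

Lemma continuous_sum_ord n (f : 'I_n -> T -> R) :
  (forall i, continuous (f i)) -> continuous (fun x => \sum_i f i x).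
Proof. by move=> cf x; apply: cvg_sum_ord => i; exact: cf. Qed.

Lemma continuous_cV n (f : T -> 'cV[R]_n) :
  (forall k, continuous (fun x => f x k 0)) -> continuous f.
Proof. by move=> cf x; apply: cvg_cV => k; exact: cf. Qed.

End continuous_real_functions.

Section exponential_moments.
Context {R : realType} {N n : nat} (c : 'cV[R]_N -> 'cV[R]_n) (Theta : set 'cV[R]_n).
Context (c_cont : forall k, continuous (fun x => c x k 0)).
Context (Theta_open : open Theta) (Theta_norm : normalizable c Theta).

Lemma dotcE th x : dotc c th x = linear_form (fun k => c x k 0) th.
Proof.
by rewrite /dotc /linear_form mxE; apply: eq_bigr => k _; rewrite mxE.
Qed.

Lemma dotcD th th' x : dotc c (th + th') x = dotc c th x + dotc c th' x.
Proof. by rewrite !dotcE linearD. Qed.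

Lemma dotcB th th' x : dotc c (th - th') x = dotc c th x - dotc c th' x.
Proof. by rewrite !dotcE linearB. Qed.

Lemma dotc_delta k (e : R) x : dotc c (e *: delta_mx k 0) x = e * c x k 0.
Proof.
rewrite dotcE /linear_form (bigD1 k)//= big1 => [|i ik]; last first.
  by rewrite !mxE (negbTE ik) mulr0 mul0r.
by rewrite !mxE !eqxx mulr1 addr0.
Qed.

Lemma dotc_continuous th : continuous (dotc c th).
Proof.
have -> : dotc c th = fun x => linear_form (fun k => c x k 0) th.
  by apply/funext => x; rewrite dotcE.
apply: continuous_sum_ord => k; apply: continuous_scale; exact: c_cont.
Qed.

Lemma norm_c_continuous : continuous (fun x => `|c x|).
Proof.
move=> x; apply: (@cvg_comp _ _ _ c Num.norm (nbhs x) (nbhs (c x))).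
  by move: x; apply: continuous_cV => k; exact: c_cont.
exact: norm_continuous.
Qed.

Lemma norm_dotc_le h x : `|dotc c h x| <= n%:R * `|h| * `|c x|.
Proof.
rewrite dotcE /linear_form (le_trans (ler_norm_sum _ _ _))//.
rewrite (_ : _ * _ = \sum_(k < n) (`|h| * `|c x|)).
  by apply: ler_sum => k _; rewrite normrM ler_pM// le_coord_norm.
by rewrite sumr_const card_ord -mulrA mulr_natl.
Qed.

Lemma integrable_expR_dotc th : Theta th -> leb_integrable (fun x => expR (dotc c th x)).
Proof.
move=> Tth.
have mh : leb_measurable (fun x => expR (dotc c th x)).
  apply: continuous_leb_measurable; apply: continuous_expR_comp; exact: dotc_continuous.
by apply: (ge0_leb_integrableP mh _).2 => [x|]; [exact: expR_ge0|exact: Theta_norm].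
Qed.

(** An exponential moment of the norm of [c]: [exp (d |c|)] is dominated by the
    sum of the [exp (+- d c_k)], each of which moves [th] to a nearby parameter
    that still lies in the open set [Theta]. *)
Lemma integrable_expR_dotc_norm th : Theta th ->
  exists2 d : R, 0 < d & leb_integrable (fun x => expR (dotc c th x + d * `|c x|)).
Proof.
move=> Tth; have /nbhs_ballP[r /= r0 rT] : nbhs th Theta by exact: open_nbhs_nbhs.
have d0 : 0 < r / 2 by rewrite divr_gt0.
have Tk k e : `|e| = r / 2 -> Theta (th + e *: delta_mx k 0).
  move=> er; apply: rT; rewrite -ball_normE /= opprD addNKr normrN normrZ er.
  apply: (@le_lt_trans _ _ (r / 2 * 1)); last by lra.
  rewrite ler_wpM2l//; first exact: ltW.
  rewrite [leLHS]/Num.norm /= mx_normrE.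
  by apply/bigmax_leP; split => // -[i j] _ /=; rewrite mxE; case: (_ && _); rewrite ?normr1 ?normr0.
exists (r / 2) => //.
apply: (@leb_integrable_le _ _ (fun x => expR (dotc c th x) +
   \sum_k (expR (dotc c (th + (r / 2) *: delta_mx k 0) x) +
           expR (dotc c (th + (- (r / 2)) *: delta_mx k 0) x)))).
- apply: continuous_leb_measurable; apply: continuous_expR_comp.
  apply: continuous_add; first exact: dotc_continuous.
  by apply: continuous_scale; exact: norm_c_continuous.
- move=> x; rewrite ger0_norm ?expR_ge0// expRD.
  apply: (@le_trans _ _ (expR (dotc c th x) *
      (1 + \sum_k (expR (r / 2 * c x k 0) + expR (- (r / 2 * c x k 0)))))).
    by rewrite ler_wpM2l ?expR_ge0// expR_norm_le_sum// ltW.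
  rewrite mulrDr mulr1 lerD2l mulr_sumr ler_sum// => k _.
  by rewrite !dotcD !dotc_delta mulNr mulrDr -!expRD.
- apply: leb_integrableD; first exact: integrable_expR_dotc.
  apply: leb_integrable_sum => k; apply: leb_integrableD; apply: integrable_expR_dotc; apply: Tk.
    by rewrite gtr0_norm.
  by rewrite normrN gtr0_norm.
Qed.

Lemma le_expR_inv (d y : R) : 0 < d -> y <= expR (d * y) / d.
Proof. by move=> d0; rewrite ler_pdivlMr// mulrC; have := expR_ge1Dx (d * y); lra. Qed.

Lemma integrable_poly_dotc th (w : 'cV[R]_N -> R) : Theta th -> continuous w ->
  (forall x, `|w x| <= (1 + `|c x|) ^+ 2) ->
  leb_integrable (fun x => w x * expR (dotc c th x)).
Proof.
move=> Tth cw wc; have [d d0 id] := integrable_expR_dotc_norm Tth.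
have d20 : 0 < d / 2 by rewrite divr_gt0.
apply: leb_integrable_le (leb_integrableZ ((1 + (d / 2)^-1) ^+ 2) id) => [|x].
  apply: continuous_leb_measurable; apply: continuous_mul => //.
  by apply: continuous_expR_comp; exact: dotc_continuous.
rewrite normrM [`|expR _|]ger0_norm ?expR_ge0// expRD [expR _ * expR _]mulrC mulrA.
rewrite ler_wpM2r ?expR_ge0// (le_trans (wc x))//.
have c0 := normr_ge0 (c x).
have e1 : 1 <= expR (d / 2 * `|c x|) by rewrite -[leLHS]expR0 ler_expR mulr_ge0// ltW.
have e2 := le_expR_inv `|c x| d20.
rewrite (_ : expR (d * _) = expR (d / 2 * `|c x|) ^+ 2); last first.
  by rewrite -expRM_natl; congr expR; field.
have di : 0 <= 1 + (d / 2)^-1 by rewrite addr_ge0// invr_ge0 ltW.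
rewrite -exprMn lerXn2r ?nnegrE ?addr_ge0 ?mulr_ge0 ?expR_ge0//.
by rewrite mulrDl mul1r lerD// mulrC.
Qed.

Definition moment (w : 'cV[R]_N -> R) (th : 'cV[R]_n) : R :=
  integ (fun x => w x * expR (dotc c th x)).

(** Differentiation under the integral sign.  The Taylor remainder of
    [exp (h . c)] is at most [(h . c)^2 exp |h . c|], and for small [h] the
    integrand is bounded by [|h|^2] times the integrable function provided by
    [integrable_expR_dotc_norm], polynomial factors in [|c|] being absorbed by
    a part of the exponential. *)
Lemma is_diff_moment th (w : 'cV[R]_N -> R) : Theta th -> continuous w ->
  (forall x, `|w x| <= 1 + `|c x|) ->
  is_diff th (moment w) (linear_form (fun k => moment (fun x => w x * c x k 0) th)).
Proof.
move=> Tth cw wc; have [D D0 iD] := integrable_expR_dotc_norm Tth.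
(* one quarter of [D] absorbs each of the factors [1 + |c|], [|c|], [|c|] and
   the exponential in the Taylor remainder *)
pose d := D / 4; have d0 : 0 < d by rewrite divr_gt0.
have /nbhs_ballP[r /= r0 rT] : nbhs th Theta by exact: open_nbhs_nbhs.
(* keeps [h + th] in [Theta] and [|h . c|] below [d |c|]; the successor covers
   dimension 0 *)
pose rho := Num.min (r / 2) (d / n.+1%:R).
have rho0 : 0 < rho by rewrite lt_min !divr_gt0.
pose G x := expR (dotc c th x + D * `|c x|).
pose K := n%:R ^+ 2 * ((1 + d^-1) * d^-1 ^+ 2).
apply: (is_diff_quadratic (K := K * integ G) rho0) => h hrho.
have Th : Theta (h + th).
  apply: rT; rewrite -ball_normE /= opprD addrCA subrr addr0 normrN.
  by move: hrho; rewrite le_min => /andP[+ _]; lra.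
have wc2 x : `|w x| <= (1 + `|c x|) ^+ 2.
  rewrite (le_trans (wc x))//; have := normr_ge0 (c x); nra.
have wck k x : `|w x * c x k 0| <= (1 + `|c x|) ^+ 2.
  rewrite normrM expr2 ler_pM//; have := le_coord_norm (c x) k; lra.
have cwk k : continuous (fun x => w x * c x k 0).
  by apply: continuous_mul => //; exact: c_cont.
have i1 := integrable_poly_dotc Th cw wc2.
have i2 := integrable_poly_dotc Tth cw wc2.
have i3 k := integrable_poly_dotc Tth (cwk k) (wck k).
have i3' k := leb_integrableZ (h k 0) (i3 k).
rewrite /moment /linear_form; under eq_bigr do rewrite -integZ//.
rewrite -integB// -integ_sum// -integB//; [|exact: leb_integrableB|exact: leb_integrable_sum].
rewrite mulrAC -integZ//.
apply: le_norm_integ; last exact: leb_integrableZ.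
  apply: leb_integrable_measurable; apply: leb_integrableB; last exact: leb_integrable_sum.
  exact: leb_integrableB.
move=> x; set u := dotc c h x.
have -> : \sum_(i < n) h i 0 * (w x * c x i 0 * expR (dotc c th x)) = w x * expR (dotc c th x) * u.
  rewrite /u [dotc c h x]dotcE /linear_form mulr_sumr; apply: eq_bigr => k _; ring.
rewrite dotcD -/u expRD.
rewrite (_ : _ - _ = w x * expR (dotc c th x) * (expR u - 1 - u)); last by ring.
rewrite !normrM [`|expR _|]ger0_norm ?expR_ge0//.
have c0 := normr_ge0 (c x); have h0 := normr_ge0 h.
have uh : `|u| <= n%:R * `|h| * `|c x| by exact: norm_dotc_le.
have ud : `|u| <= d * `|c x|.
  apply: (le_trans uh); rewrite ler_wpM2r//.
  have : `|h| <= d / n.+1%:R by move: hrho; rewrite le_min => /andP[].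
  rewrite ler_pdivlMr// => /(le_trans _); apply.
  by rewrite mulrC ler_wpM2l// ler_nat.
have e1 : 1 <= expR (d * `|c x|) by rewrite -[leLHS]expR0 ler_expR mulr_ge0// ltW.
have e2 := le_expR_inv `|c x| d0.
apply: (@le_trans _ _ ((1 + `|c x|) * expR (dotc c th x) *
    ((n%:R * `|h| * `|c x|) ^+ 2 * expR (d * `|c x|)))).
  rewrite ler_pM ?mulr_ge0 ?expR_ge0 ?ler_wpM2r ?expR_ge0 ?wc//.
  apply: le_trans (expR_taylor1_remainder u) _.
  rewrite ler_pM ?sqr_ge0 ?expR_ge0 ?ler_expR// -[u ^+ 2]real_normK ?num_real//.
  by rewrite lerXn2r// nnegrE ?(le_trans _ uh).
rewrite /G expRD /K.
rewrite (_ : expR (D * _) = expR (d * `|c x|) ^+ 4); last first.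
  by rewrite -expRM_natl; congr expR; rewrite /d; field.
set E := expR (d * _) in e1 e2 *; set y := `|c x| in c0 e2 *.
have y1 : 1 + y <= (1 + d^-1) * E by rewrite mulrDl mul1r [d^-1 * E]mulrC lerD.
have di : 0 <= d^-1 by rewrite invr_ge0 ltW.
have y2 : y ^+ 2 <= d^-1 ^+ 2 * E ^+ 2.
  by rewrite -exprMn lerXn2r ?nnegrE ?(mulrC d^-1)// mulr_ge0// (le_trans _ e1).
rewrite [leLHS](_ : _ = expR (dotc c th x) * n%:R ^+ 2 * `|h| ^+ 2 * E * ((1 + y) * y ^+ 2)); last by ring.
rewrite [leRHS](_ : _ = expR (dotc c th x) * n%:R ^+ 2 * `|h| ^+ 2 * E *
  (((1 + d^-1) * E) * (d^-1 ^+ 2 * E ^+ 2))); last by ring.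
rewrite ler_wpM2l ?mulr_ge0 ?expR_ge0 ?exprn_ge0// ler_pM ?exprn_ge0 ?addr_ge0//.
Qed.

End exponential_moments.

(** * Geometry of the exponential family *)

Lemma cov_expand {R : realType} {N : nat} (q U V : 'cV[R]_N -> R) :
  leb_integrable q -> integ q = 1 ->
  leb_integrable (fun x => U x * q x) -> leb_integrable (fun x => V x * q x) ->
  leb_integrable (fun x => U x * V x * q x) ->
  cov q U V = expect q (fun x => U x * V x) - expect q U * expect q V.
Proof.
move=> iq q1 iU iV iUV; rewrite /cov /expect.
set u := integ (fun x => U x * q x); set v := integ (fun x => V x * q x).
transitivity (integ (fun x => (U x * V x * q x - v * (U x * q x)) - u * (V x * q x) + u * v * q x)).
  by congr integ; apply/funext => x; ring.
rewrite integD ?integB ?integZ//; last exact: leb_integrableZ.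
- by rewrite q1 -/u -/v; ring.
- exact: leb_integrableZ.
- by apply: leb_integrableB => //; exact: leb_integrableZ.
- exact: leb_integrableZ.
- by apply: leb_integrableB; [apply: leb_integrableB => //|]; exact: leb_integrableZ.
Qed.

Lemma expect_centered {R : realType} {N : nat} (q D : 'cV[R]_N -> R) (b : R) :
  leb_integrable q -> integ q = 1 -> leb_integrable (fun x => D x * q x) ->
  leb_integrable (fun x => (D x - b) * q x) /\
  integ (fun x => (D x - b) * q x) = expect q D - b.
Proof.
move=> iq q1 iD; have ib := leb_integrableZ b iq.
have -> : (fun x => (D x - b) * q x) = (fun x => D x * q x - b * q x).
  by apply/funext => x; rewrite mulrBl.
by split; [exact: leb_integrableB|rewrite integB// integZ// q1 mulr1].
Qed.

Section exponential_family_geometry.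
Context {R : realType} {N n : nat} (c : 'cV[R]_N -> 'cV[R]_n) (Theta : set 'cV[R]_n).
Context (c_cont : forall k, continuous (fun x => c x k 0)).
Context (Theta_open : open Theta) (Theta_norm : normalizable c Theta).
Implicit Types (th v : 'cV[R]_n).

Notation Z := (moment c (fun=> 1)).
Notation eta th := (fun k => expect_param c th k 0).

Lemma psiE : psi c = @ln R \o Z.
Proof.
by apply/funext => th; rewrite /psi /= /moment; congr (ln (integ _)); apply/funext => x; rewrite mul1r.
Qed.

Lemma partition_gt0 th : Theta th -> 0 < Z th.
Proof.
move=> Tth; apply: integ_gt0 => [|x]; last by rewrite mul1r expR_gt0.
apply: (integrable_poly_dotc c_cont Theta_open Theta_norm) => // x.
  exact: cst_continuous.
by rewrite normr1 expr_ge1// lerDl.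
Qed.

Lemma densE th x : Theta th -> dens c th x = (Z th)^-1 * expR (dotc c th x).
Proof.
move=> Tth; rewrite /dens expRB psiE /= lnK 1?mulrC//.
by rewrite posrE; exact: partition_gt0.
Qed.

Lemma dens_gt0 th x : 0 < dens c th x.
Proof. exact: expR_gt0. Qed.

Lemma dens_ratio th th' x :
  dens c th' x = dens c th x * expR (dotc c (th' - th) x - (psi c th' - psi c th)).
Proof.
rewrite /dens -expRD dotcB; congr expR.
by move: (psi c th) (psi c th') (dotc c th x) (dotc c th' x) => *; ring.
Qed.

Lemma dens_continuous th : continuous (dens c th).
Proof.
apply: continuous_expR_comp; apply: continuous_add; last exact: cst_continuous.
exact: dotc_continuous.
Qed.

Section moments_at_a_parameter.
Context (th : 'cV[R]_n) (Tth : Theta th).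

Lemma expect_dens (w : 'cV[R]_N -> R) : continuous w -> (forall x, `|w x| <= (1 + `|c x|) ^+ 2) ->
  leb_integrable (fun x => w x * dens c th x) /\
  expect (dens c th) w = moment c w th / Z th.
Proof.
move=> cw wc; have iw := integrable_poly_dotc c_cont Theta_open Theta_norm Tth cw wc.
have wE : (fun x => w x * dens c th x) = (fun x => (Z th)^-1 * (w x * expR (dotc c th x))).
  by apply/funext => x; rewrite densE// mulrCA.
rewrite /expect wE; split; first exact: leb_integrableZ.
by rewrite integZ// mulrC.
Qed.

Let one_le x : `|1 : R| <= (1 + `|c x|) ^+ 2.
Proof. by rewrite normr1 expr_ge1// lerDl. Qed.

Let ck_le k x : `|c x k 0| <= (1 + `|c x|) ^+ 2.
Proof. by have := le_coord_norm (c x) k; have := normr_ge0 (c x); nra. Qed.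

Let cik_le i k x : `|c x i 0 * c x k 0| <= (1 + `|c x|) ^+ 2.
Proof.
rewrite normrM expr2 ler_pM//.
  by have := le_coord_norm (c x) i; lra.
by have := le_coord_norm (c x) k; lra.
Qed.

Let cik_cont i k : continuous (fun x => c x i 0 * c x k 0).
Proof. by apply: continuous_mul; exact: c_cont. Qed.

Lemma integrable_dens : leb_integrable (dens c th).
Proof.
have [+ _] := expect_dens (@cst_continuous _ _ (1 : R)) one_le.
by congr leb_integrable; apply/funext => x; rewrite mul1r.
Qed.

Lemma integ_dens : integ (dens c th) = 1.
Proof.
have [_] := expect_dens (@cst_continuous _ _ (1 : R)) one_le.
rewrite divff ?gt_eqF ?partition_gt0// => <-.
by congr integ; apply/funext => x; rewrite mul1r.
Qed.

Lemma integrable_c_dens k : leb_integrable (fun x => c x k 0 * dens c th x).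
Proof. by have [] := expect_dens (@c_cont k) (ck_le k). Qed.

Lemma integrable_cc_dens i k :
  leb_integrable (fun x => c x i 0 * c x k 0 * dens c th x).
Proof. by have [] := expect_dens (@cik_cont i k) (cik_le i k). Qed.

Lemma expect_paramE k : expect_param c th k 0 = expect (dens c th) (fun x => c x k 0).
Proof. by rewrite mxE. Qed.

Lemma expect_param_moment k :
  expect_param c th k 0 = moment c (fun x => c x k 0) th / Z th.
Proof. by rewrite expect_paramE; have [] := expect_dens (@c_cont k) (ck_le k). Qed.

Lemma fisher_moment i k : fisher c th i k =
  moment c (fun x => c x i 0 * c x k 0) th / Z th -
  expect_param c th i 0 * expect_param c th k 0.
Proof.
rewrite mxE cov_expand ?integ_dens//; last exact: integrable_cc_dens.
- have [_ ->] := expect_dens (@cik_cont i k) (cik_le i k).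
  by rewrite !expect_paramE.
- exact: integrable_dens.
- exact: integrable_c_dens.
- exact: integrable_c_dens.
Qed.

Lemma fisher_sym : (fisher c th)^T = fisher c th.
Proof.
apply/matrixP => i k; rewrite mxE !fisher_moment; congr (_ / _ - _); last exact: mulrC.
by congr integ; apply/funext => x; rewrite (mulrC (c x k 0)).
Qed.

Lemma integrable_dotc_dens v : leb_integrable (fun x => dotc c v x * dens c th x).
Proof.
have -> : (fun x => dotc c v x * dens c th x) =
    (fun x => \sum_k v k 0 * (c x k 0 * dens c th x)).
  apply/funext => x; rewrite dotcE /linear_form mulr_suml.
  by apply: eq_bigr => k _; rewrite mulrA.
by apply: leb_integrable_sum => k; apply: leb_integrableZ; exact: integrable_c_dens.
Qed.

Lemma expect_dotc v : expect (dens c th) (dotc c v) = linear_form (eta th) v.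
Proof.
transitivity (integ (fun x => \sum_k v k 0 * (c x k 0 * dens c th x))).
  congr integ; apply/funext => x; rewrite dotcE /linear_form mulr_suml.
  by apply: eq_bigr => k _; rewrite mulrA.
rewrite integ_sum; last by move=> k; apply: leb_integrableZ; exact: integrable_c_dens.
apply: eq_bigr => k _; rewrite integZ; last exact: integrable_c_dens.
by rewrite expect_paramE.
Qed.

Lemma integrable_centered_dens i k (a b : R) :
  leb_integrable (fun x => (c x i 0 - a) * (c x k 0 - b) * dens c th x).
Proof.
have -> : (fun x => (c x i 0 - a) * (c x k 0 - b) * dens c th x) =
    (fun x => (c x i 0 * c x k 0 * dens c th x - b * (c x i 0 * dens c th x)) -
              (a * (c x k 0 * dens c th x) - a * b * dens c th x)).
  by apply/funext => x; move: (dens c th x) => q; ring.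
apply: leb_integrableB; apply: leb_integrableB.
- exact: integrable_cc_dens.
- by apply: leb_integrableZ; exact: integrable_c_dens.
- by apply: leb_integrableZ; exact: integrable_c_dens.
- by apply: leb_integrableZ; exact: integrable_dens.
Qed.

(** [g v] is the covariance of [c] with [v . c]; this is what makes the kernel
    of [g] visible. *)
Lemma fisher_mulE v i : (fisher c th *m v) i 0 =
  integ (fun x => (c x i 0 - expect_param c th i 0) *
                  (dotc c v x - linear_form (eta th) v) * dens c th x).
Proof.
pose g k x := v k 0 * ((c x i 0 - expect_param c th i 0) *
  (c x k 0 - expect_param c th k 0) * dens c th x).
transitivity (integ (fun x => \sum_k g k x)).
  rewrite integ_sum => [|k]; last exact/leb_integrableZ/integrable_centered_dens.
  rewrite mxE; apply: eq_bigr => k _; rewrite mulrC mxE /g integZ.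
    by rewrite /cov /expect !expect_paramE.
  exact: integrable_centered_dens.
congr integ; apply/funext => x; rewrite dotcE /linear_form -sumrB mulr_sumr mulr_suml.
by apply: eq_bigr => k _; rewrite /g;
  move: (dens c th x) (expect_param _ _ _ _) (expect_param _ _ _ _) => *; ring.
Qed.

(** The gradient of the log-partition function is the mean of [c]. *)
Lemma is_diff_psi : is_diff th (psi c) (linear_form (eta th)).
Proof.
have c1 : forall x, `|1 : R| <= 1 + `|c x| by move=> x; rewrite normr1 lerDl.
have dZ := is_diff_moment c_cont Theta_open Theta_norm Tth (@cst_continuous _ _ (1 : R)) c1.
have dln : is_diff (Z th) (@ln R) ( *:%R^~ (Z th)^-1).
  have dd := is_derive1_ln (partition_gt0 Tth).
  have dl : differentiable (@ln R) (Z th) by apply/derivable1_diffP; exact: ex_derive.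
  apply: DiffDef => //; rewrite deriv1E; last exact/derivable1_diffP.
  by rewrite derive1E derive_val.
rewrite psiE; apply: is_diff_eq (is_diff_comp dZ dln) _.
apply/funext => v; rewrite /= /linear_form scaler_suml; apply: eq_bigr => k _.
rewrite expect_param_moment [LHS]/GRing.scale /= -mulrA; congr (_ * _).
by rewrite /moment; congr (integ _ / _); apply/funext => x; rewrite mul1r.
Qed.

(** The Jacobian of the mean map is the Fisher matrix.  The quotient is used
    instead of [expect_param], with which it agrees on [Theta] only. *)
Lemma is_diff_mean i : is_diff th (fun s => moment c (fun x => c x i 0) s / Z s)
  (linear_form (fun k => fisher c th i k)).
Proof.
have c1 : forall x, `|1 : R| <= 1 + `|c x| by move=> x; rewrite normr1 lerDl.
have ci : forall x, `|c x i 0| <= 1 + `|c x|.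
  by move=> x; have := le_coord_norm (c x) i; lra.
have dZ := is_diff_moment c_cont Theta_open Theta_norm Tth (@cst_continuous _ _ (1 : R)) c1.
have dm := is_diff_moment c_cont Theta_open Theta_norm Tth (@c_cont i) ci.
have Z0 : Z th != 0 by rewrite gt_eqF// partition_gt0.
have dV : is_diff th (fun s => (Z s)^-1) (- (Z th) ^- 2 \*: 'd Z th).
  by apply: DiffDef; [exact: differentiableV|rewrite diffV].
apply: is_diff_eq (is_diffM dm dV) _.
apply/funext => v; rewrite /= !fctE diff_val.
rewrite /linear_form /= !scaler_sumr -big_split /=; apply: eq_bigr => k _.
rewrite fisher_moment !expect_param_moment.
have -> : moment c (fun x => 1 * c x k 0) th = moment c (fun x => c x k 0) th.
  by rewrite /moment; congr integ; apply/funext => x; rewrite mul1r.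
rewrite /GRing.scale /=; field; exact: Z0.
Qed.

End moments_at_a_parameter.

(** Convexity of [psi] in gradient form.  The likelihood ratio of the two
    densities is [exp D] with [D = (th' - th) . c - (psi th' - psi th)];
    integrate [exp D >= 1 + D] against [dens c th]. *)
Lemma psi_convex_ineq th th' : Theta th -> Theta th' ->
  linear_form (eta th) (th' - th) <= psi c th' - psi c th.
Proof.
move=> Tth Tth'; set b := psi c th' - psi c th.
have [iD ID] := expect_centered b (integrable_dens Tth) (integ_dens Tth)
  (integrable_dotc_dens Tth (th' - th)).
rewrite -subr_le0 -(expect_dotc Tth) -ID.
have I0 := integB (integrable_dens Tth') (integrable_dens Tth).
move: I0; rewrite [X in X - _](integ_dens Tth').
rewrite [X in _ - X](integ_dens Tth).
rewrite subrr => <-.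
apply: le_integ => [//||x]; first by apply: leb_integrableB; exact: integrable_dens.
rewrite (dens_ratio th th') -/b lerBrDr -[X in _ + X]mul1r -mulrDl mulrC.
rewrite ler_wpM2l ?(ltW (dens_gt0 _ _))//.
by have := expR_ge1Dx (dotc c (th' - th) x - b); rewrite addrC.
Qed.

(** If [v . c] is almost surely constant then its covariance with every [c_i]
    vanishes.  The exceptional set is encoded as the complement of the zero set
    of a nonnegative [h] of integral zero. *)
Lemma fisher_kernel th v (h : 'cV[R]_N -> R) : Theta th ->
  leb_integrable h -> (forall x, 0 <= h x) -> integ h = 0 ->
  (forall x, h x = 0 -> dotc c v x = linear_form (eta th) v) ->
  fisher c th *m v = 0.
Proof.
move=> Tth ih h0 Ih0 hv; apply/matrixP => i j; rewrite (ord1 j) fisher_mulE// [RHS]mxE.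
apply: (integ_eq0_supp ih h0 Ih0) => [|x hx0]; last by rewrite hv// subrr mulr0 mul0r.
apply: continuous_leb_measurable; apply: continuous_mul; last exact: dens_continuous.
apply: continuous_mul; apply: continuous_add; try exact: cst_continuous.
  exact: c_cont.
exact: dotc_continuous.
Qed.

Context (fisher_inv : forall th, Theta th -> fisher c th \in unitmx).

Lemma fisher_mul_inj th v : Theta th -> fisher c th *m v = 0 -> v = 0.
Proof.
by move=> Tth gv0; rewrite -[v](mulKmx (fisher_inv Tth)) gv0 mulmx0.
Qed.

Lemma dotc_centered_inj th v : Theta th ->
  (forall x, dotc c v x = linear_form (eta th) v) -> v = 0.
Proof.
move=> Tth hv; apply: (fisher_mul_inj Tth).
(* with [h = 0] the exceptional set is empty *)
apply: (@fisher_kernel th v (fun=> 0)) => //; first exact: leb_integrable0.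
exact: integ0.
Qed.

(** With [v = th' - th] and [D] the log-likelihood ratio, the difference of the
    expectations of [D] under [th'] and [th] is the integral of
    [D (exp D - 1) dens c th >= 0].  Equal expectation parameters make it zero,
    so [D] vanishes almost surely, [v . c] is almost surely constant, and [v]
    lies in the kernel of the Fisher matrix. *)
Lemma expect_param_inj th th' : Theta th -> Theta th' ->
  expect_param c th = expect_param c th' -> th = th'.
Proof.
move=> Tth Tth' etaE; apply/esym/eqP; rewrite -subr_eq0; apply/eqP.
set v := th' - th; pose b := psi c th' - psi c th.
pose D x := dotc c v x - b.
have DP s (Ts : Theta s) := expect_centered b (integrable_dens Ts) (integ_dens Ts)
  (integrable_dotc_dens Ts v).
have iD s : Theta s -> leb_integrable (fun x => D x * dens c s x).
  by move=> /DP[].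
have ID s : Theta s -> integ (fun x => D x * dens c s x) = linear_form (eta s) v - b.
  by move=> Ts; have [_] := DP s Ts; rewrite (expect_dotc Ts).
pose h x := D x * (expR (D x) - 1) * dens c th x.
(* [exp D] is the likelihood ratio, so [h] compares the two expectations of [D] *)
have hE : h = fun x => D x * dens c th' x - D x * dens c th x.
  apply/funext => x; rewrite /h (dens_ratio th th') -/v -/b -/(D x).
  by move: (dens c th x) (D x) (expR _) => *; ring.
have ih : leb_integrable h by rewrite hE; apply: leb_integrableB; exact: iD.
have Dpos (u : R) : 0 <= u * (expR u - 1).
  have [u0|u0] := lerP 0 u.
    by apply: mulr_ge0; [exact: u0|have := expR_ge1Dx u; lra].
  by apply: mulr_le0; [exact: ltW|rewrite subr_le0 expR_le1; exact: ltW].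
have h0 x : 0 <= h x.
  by apply: mulr_ge0; [exact: Dpos|apply: ltW; exact: dens_gt0].
have Ih0 : integ h = 0.
  rewrite hE; apply: etrans (integB (iD _ Tth') (iD _ Tth)) _.
  rewrite [X in X - _](ID _ Tth').
  rewrite [X in _ - X](ID _ Tth).
  by rewrite etaE subrr.
have hD x : h x = 0 -> D x = 0.
  move=> /eqP; rewrite /h !mulf_eq0 (gt_eqF (dens_gt0 _ _)) orbF.
  move=> /orP[/eqP //|]; rewrite subr_eq0 => /eqP e1.
  by apply: expR_inj; rewrite expR0; exact: e1.
have bE : linear_form (eta th) v = b.
  apply/eqP; rewrite -subr_eq0 -(ID _ Tth); apply/eqP; apply: (integ_eq0_supp ih h0 Ih0).
    by apply: leb_integrable_measurable; exact: (iD _ Tth).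
  by move=> x /hD ->; rewrite mul0r.
apply: (fisher_mul_inj Tth); apply: (fisher_kernel Tth ih h0 Ih0) => x /hD.
by rewrite /D bE => /eqP; rewrite subr_eq0 => /eqP.
Qed.

Lemma dens_of_eta_expect_param th : Theta th ->
  dens_of_eta c Theta (expect_param c th) = dens c th.
Proof.
move=> Tth; apply: xget_unique; first by split => //; exists th.
by move=> _ [[s Ts <-]] /= sE; congr dens; apply: expect_param_inj.
Qed.

(** The projection lies in the tangent space; its coordinates are those of the
    covariance vector multiplied by the inverse Fisher matrix, which is
    symmetric. *)
Lemma tangent_projE th (U : 'cV[R]_N -> R) x : Theta th ->
  tangent_proj c th U x =
  let v := invmx (fisher c th) *m \col_i cov (dens c th) U (fun y => c y i 0) in
  dotc c v x - linear_form (eta th) v.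
Proof.
move=> Tth /=; set g := invmx _; set v := g *m _.
have gT : g^T = g by rewrite /g trmx_inv fisher_sym.
rewrite dotcE /linear_form -sumrB /tangent_proj exchange_big /=.
apply: eq_bigr => j _; rewrite -mulrBr expect_paramE mxE mulr_suml.
by apply: eq_bigr => i _; rewrite [in RHS]mxE -[in RHS]gT mxE.
Qed.

End exponential_family_geometry.

(** * Derivatives relative to a set *)

Section one_sided_derivatives.
Context {R : realType}.

(** Every point of a nondegenerate interval is a limit point of it: move from
    [t] a small fraction of the way towards another point of the interval. *)
Lemma within_dnbhs_proper (J : set R) t : nondegenerate_interval J -> J t ->
  ProperFilter (within J t^').
Proof.
move=> [itvJ [a [b [Ja Jb ab]]]] Jt; apply: Build_ProperFilter_ex => P.
rewrite /within /= => -[e /= e0 eP].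
have [s Js st] : exists2 s, J s & s != t.
  have [at_|] := eqVneq a t; last by exists a.
  by exists b => //; rewrite -at_ gt_eqF.
pose k := Num.min 1 (e / 2 / `|s - t|).
have st0 : 0 < `|s - t| by rewrite normr_gt0 subr_eq0.
have k0 : 0 < k by rewrite lt_min ltr01 !divr_gt0.
have k1 : k <= 1 by rewrite ge_min lexx.
have ke : k * `|s - t| <= e / 2.
  by rewrite -ler_pdivlMr// ge_min lexx orbT.
exists (t + k * (s - t)); apply: eP.
- rewrite /ball_ /= opprD addNKr normrN normrM gtr0_norm//.
  by apply: (le_lt_trans ke); lra.
- by rewrite /= -subr_eq0 addrC addKr mulf_neq0 ?subr_eq0// gt_eqF.
- move: st; rewrite neq_lt => /orP[st|ts].
  + by apply: (itvJ s t) => //; apply/andP; split; nra.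
  + by apply: (itvJ t s) => //; apply/andP; split; nra.
Qed.

Lemma is_deriv_on_unique {V : normedModType R} (J : set R) (g : R -> V) t l l' :
  nondegenerate_interval J -> J t ->
  is_deriv_on J g t l -> is_deriv_on J g t l' -> l = l'.
Proof.
move=> iJ Jt gl gl'; have PJ := within_dnbhs_proper iJ Jt.
exact: (cvg_unique _ gl gl').
Qed.

Lemma is_deriv_onE {V : normedModType R} (J : set R) (g : R -> V) t l :
  nondegenerate_interval J -> J t -> is_deriv_on J g t l -> deriv_on J g t = l.
Proof.
move=> iJ Jt gl; have PJ := within_dnbhs_proper iJ Jt.
exact: (cvg_lim _ gl).
Qed.

Lemma eq_is_deriv_on {V : normedModType R} (J : set R) (f g : R -> V) t l :
  J t -> (forall s, J s -> f s = g s) ->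
  is_deriv_on J f t l -> is_deriv_on J g t l.
Proof.
move=> Jt fg; rewrite /is_deriv_on; apply: cvg_trans; apply: near_eq_cvg.
rewrite near_withinE; near=> s => Js.
by rewrite fg// fg.
Unshelve. all: by end_near. Qed.

(** Chain rule for derivatives relative to a set.  The remainder of [F] is at
    most [e |g s - g t|], and the difference quotients of [g] stay bounded. *)
Lemma is_deriv_on_comp {V W : normedModType R} (J : set R) (g : R -> V) (t : R) (l : V)
    (F dF : V -> W) : is_diff (g t) F dF ->
  is_deriv_on J g t l -> is_deriv_on J (F \o g) t (dF l).
Proof.
move=> dFg gl; set Fi := within J t^'.
have FF : Filter Fi by exact: within_filter.
pose q s := (s - t)^-1 *: (g s - g t).
have qK s : s != t -> g s - g t = (s - t) *: q s.
  by move=> st; rewrite /q scalerA divff ?scale1r// subr_eq0.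
have nt : \forall s \near Fi, s != t.
  by rewrite near_withinE; near=> s => _; near: s; exact: nbhs_dnbhs_neq.
have st0 : (fun s => s - t) @ Fi --> (0 : R).
  rewrite -(subrr t); apply: cvgB; last exact: cvg_cst.
  apply: cvg_trans (cvg_within _) _; exact: nbhs_dnbhs.
have gt0 : (fun s => g s - g t) @ Fi --> (0 : V).
  have : (fun s => (s - t) *: q s) @ Fi --> (0 : V).
    by rewrite -(scale0r l); apply: cvgZ.
  apply: cvg_trans; apply: near_eq_cvg; apply: filterS nt => s st.
  by rewrite -qK.
have cdF : continuous dF.
  by rewrite -(@diff_val _ _ _ _ _ _ _ dFg); apply: diff_continuous; exact: ex_diff.
have Fdiff : differentiable F (g t) by exact: ex_diff.
have linF : 'd F (g t) = dF :> (V -> W) by exact: diff_val.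
have dFq : dF (q s) @[s --> Fi] --> dF l by apply: continuous_cvg => //; exact: cdF.
rewrite /is_deriv_on.
have -> : dF l = dF l + 0 by rewrite addr0.
pose r s := (s - t)^-1 *: (F (g s) - F (g t) - 'd F (g t) (g s - g t)).
have : dF (q s) + r s @[s --> Fi] --> dF l + 0.
  apply: cvgD => //.
  apply/cvgr0Pnorm_le => e e0.
  pose e1 := e / (`|l| + 1).
  have l1 : 0 < `|l| + 1 by rewrite ltr_wpDl.
  have e10 : 0 < e1 by rewrite divr_gt0.
  have [_ /eqaddoP /(_ _ e10)] := (diff_locallyP _ _).1 Fdiff.
  move=> /gt0 Hg.
  have ql : \forall s \near Fi, `|q s| <= `|l| + 1.
    by apply: (cvgr_norm_le l gl); rewrite ltrDl.
  near=> s.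
  have st : s != t by near: s.
  have : `|F (g s) - F (g t) - 'd F (g t) (g s - g t)| <= e1 * `|g s - g t|.
    have : `|(F \o shift (g t) - (cst (F (g t)) + 'd F (g t))) (g s - g t)| <= e1 * `|id (g s - g t)|.
      by near: s.
    by rewrite !fctE /= subrK opprD addrA.
  rewrite /r normrZ normfV => H.
  rewrite ler_pdivrMl ?normr_gt0 ?subr_eq0//.
  apply: (le_trans H); rewrite qK// normrZ mulrCA ler_wpM2l//.
  rewrite /e1 mulrAC ler_pdivrMr// ler_wpM2l//; first exact: ltW.
  by near: s.
apply: cvg_trans; apply: near_eq_cvg; near=> s => /=.
rewrite /r /q -linF linearZ -scalerDr; congr (_ *: _).
by rewrite addrC subrK.
Unshelve. all: by end_near. Qed.

Lemma is_deriv_on_cV {n} (J : set R) (g : R -> 'cV[R]_n) t (l : 'cV[R]_n) :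
  is_deriv_on J g t l <-> forall k, is_deriv_on J (fun s => g s k 0) t (l k 0).
Proof.
set Fi := within J t^'.
have FF : Filter Fi by exact: within_filter.
have qE k : (fun s => (s - t)^-1 *: (g s k 0 - g t k 0)) =
    (fun s => ((s - t)^-1 *: (g s - g t)) k 0).
  by apply/funext => s; rewrite !mxE.
split=> [gl k|gl].
  rewrite /is_deriv_on qE.
  exact: (@cvg_comp _ _ _ (fun s => (s - t)^-1 *: (g s - g t)) (fun M : 'cV[R]_n => M k 0)
    Fi (nbhs l) (nbhs (l k 0)) gl (@coord_continuous R n 1 k 0 l)).
by apply: cvg_cV => k; have := gl k; rewrite /is_deriv_on qE.
Qed.

End one_sided_derivatives.

(** * Kullback-Leibler projection onto the family *)

Lemma is_diff_linear_form {R : realType} {n : nat} (L : 'I_n -> R) (th : 'cV[R]_n) :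
  is_diff th (linear_form L) (linear_form L).
Proof.
apply: (@is_diff_quadratic _ _ _ _ _ 0 1) => // h _.
by rewrite linearD addrK subrr normr0 mul0r.
Qed.

(** From [ln y <= y - 1] at [y = r / q]. *)
Lemma relative_entropy_ge (R : realType) (q r : R) : 0 <= q -> 0 < r ->
  - r <= q * ln (q / r).
Proof.
move=> q0 r0; have [->|qn0] := eqVneq q 0; first by rewrite mul0r oppr_le0 ltW.
have qp : 0 < q by rewrite lt_neqAle eq_sym qn0.
have rq0 : 0 < r / q by rewrite divr_gt0.
have lnE : ln (q / r) = - ln (r / q).
  by rewrite -lnV ?posrE// invf_div.
have := @le_ln1Dx R (r / q - 1) ltac:(by rewrite ltrBrDl subrr).
rewrite addrC subrK => le1.
have : q * ln (r / q) <= q * (r / q - 1) by rewrite ler_wpM2l.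
rewrite lnE mulrN mulrBr mulr1 mulrCA divff// mulr1 => H; lra.
Qed.

(** The extended integral of a signed function is the difference of the
    integrals of its positive and negative parts; when the latter is finite,
    finiteness of the integral is integrability. *)
Lemma leb_integrable_bounded_below {R : realType} {N : nat} (h r : 'cV[R]_N -> R) :
  leb_measurable h -> leb_integrable r -> (forall x, 0 <= r x) ->
  (forall x, - r x <= h x) -> (integ_ext h < +oo)%E -> leb_integrable h.
Proof.
move=> mh ir r0 rh; rewrite /integ_ext integralE => hoo.
pose hn x := Num.max (- h x) 0; pose hp x := Num.max (h x) 0.
have mhn : leb_measurable hn by apply: measurable_maxr => //; exact: measurable_funN.
have mhp : leb_measurable hp by apply: measurable_maxr.
have ihn : leb_integrable hn.
  apply: leb_integrable_le ir => // x.
  rewrite ger0_norm /hn ?le_max ?lexx ?orbT// ge_max r0 andbT.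
  by have := rh x; lra.
have hnE : (\int[@lebN R N]_x (EFin \o (h \o vec))^\- x = (integ hn)%:E)%E.
  rewrite -integ_extE//; apply: eq_integral => x _.
  by rewrite funenegE /= /hn EFin_max.
have ihp : leb_integrable hp.
  apply/(ge0_leb_integrableP mhp) => [x|]; first by rewrite /hp le_max lexx orbT.
  have -> : integ_ext hp = (\int[@lebN R N]_x (EFin \o (h \o vec))^\+ x)%E.
    by apply: eq_integral => x _; rewrite funeposE /= /hp EFin_max.
  move: hoo; rewrite -[X in (_ - X)%E]/((\int[@lebN R N]_x (EFin \o (h \o vec))^\- x)%E) hnE.
  set Ip := (X in (X - _)%E); rewrite -[X in _ -> (X < _)%E]/Ip.
  by case: Ip => [u _|//|_ //]; exact: ltry.
have -> : h = fun x => hp x - hn x.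
  apply/funext => x; rewrite /hp /hn; case: (lerP (h x) 0) => hx.
    by rewrite max_l ?oppr_ge0// sub0r opprK.
  by rewrite max_r ?subr0// oppr_le0 ltW.
exact: leb_integrableB.
Qed.

Section KL_projection.
Context {R : realType} {N n : nat} (c : 'cV[R]_N -> 'cV[R]_n) (Theta : set 'cV[R]_n).
Context (c_cont : forall k, continuous (fun x => c x k 0)).
Context (Theta_open : open Theta) (Theta_norm : normalizable c Theta).
Context (q : 'cV[R]_N -> R) (q_ge0 : forall x, 0 <= q x) (mq : leb_measurable q).
Context (iq : leb_integrable q) (q1 : integ q = 1).
Context (icq : forall k, leb_integrable (fun x => c x k 0 * q x)).

Notation m := (fun k => expect_vec q c k 0).

Lemma integrable_dotc_density v : leb_integrable (fun x => dotc c v x * q x) /\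
  expect q (dotc c v) = linear_form m v.
Proof.
have E : (fun x => dotc c v x * q x) = (fun x => \sum_k v k 0 * (c x k 0 * q x)).
  apply/funext => x; rewrite dotcE /linear_form mulr_suml.
  by apply: eq_bigr => k _; rewrite mulrA.
have ivk k := leb_integrableZ (v k 0) (icq k).
split; first by rewrite E; exact: leb_integrable_sum.
rewrite /expect E integ_sum//; apply: eq_bigr => k _.
by rewrite integZ// mxE.
Qed.

Let ent th x := q x * ln (q x / dens c th x).

Lemma ln_dens th x : ln (dens c th x) = dotc c th x - psi c th.
Proof. exact: expRK. Qed.

(** Splitting the logarithm is licit where [q] is positive; where it vanishes,
    the factor [q] makes all terms zero. *)
Lemma relative_entropyE th x :
  ent th x = q x * ln (q x) - (dotc c th x - psi c th) * q x.
Proof.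
rewrite /ent; have [->|qn0] := eqVneq (q x) 0; first by rewrite !mul0r mulr0 subr0.
have qp : 0 < q x by rewrite lt_neqAle eq_sym qn0 q_ge0.
rewrite ln_div ?posrE//; last exact: dens_gt0.
by rewrite ln_dens mulrBr [X in _ - X]mulrC.
Qed.

(** The term [q ln q] is common to both divergences and cancels; what is left
    is the integral of an affine function of [c] against [q]. *)
Lemma KL_dens_le th th' : Theta th -> (KL q (dens c th) < +oo)%E ->
  (KL q (dens c th) <= KL q (dens c th'))%E =
  (0 <= psi c th' - psi c th - linear_form m (th' - th)).
Proof.
move=> Tth KLoo.
have ment : leb_measurable (ent th).
  have -> : ent th = fun x => q x * ln (q x) - (dotc c th x - psi c th) * q x.
    by apply/funext => x; exact: relative_entropyE.
  apply: measurable_funB.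
    apply: (@leb_measurableM R N q (fun x => ln (q x))) => //.
    exact: (measurableT_comp (@measurable_ln R) mq).
  apply: (@leb_measurableM R N (fun x => dotc c th x - psi c th) q) => //.
  apply: continuous_leb_measurable.
  by apply: continuous_add; [exact: dotc_continuous|exact: cst_continuous].
have ient : leb_integrable (ent th).
  apply: (leb_integrable_bounded_below ment _ _ _ KLoo).
  - exact: (integrable_dens c_cont Theta_open Theta_norm Tth).
  - by move=> x; apply: ltW; exact: dens_gt0.
  - by move=> x; apply: relative_entropy_ge; [exact: q_ge0|exact: dens_gt0].
have [id Id] := integrable_dotc_density (th' - th).
have [ic Ic] := expect_centered (psi c th' - psi c th) iq q1 id.
have KLE : KL q (dens c th) = (integ (ent th))%:E by exact: integ_extE.
have entE : (fun x => q x * ln (q x / dens c th' x)) =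
    (fun x => ent th x - (dotc c (th' - th) x - (psi c th' - psi c th)) * q x).
  apply/funext => x; rewrite -[LHS]/(ent th' x) !relative_entropyE dotcB.
  by move: (psi c th) (psi c th') (ln (q x)) (q x) (dotc c th x) (dotc c th' x) => *; ring.
have KLE' : KL q (dens c th') =
    (integ (ent th) + (psi c th' - psi c th - linear_form m (th' - th)))%:E.
  rewrite /KL entE integ_extE; last exact: leb_integrableB.
  congr EFin; apply: etrans (integB ient ic) _.
  by congr (_ + _); rewrite Ic Id opprB.
by rewrite [X in (X <= _)%E]KLE [X in (_ <= X)%E]KLE' lee_fin lerDl.
Qed.

(** First order condition: differentiate [psi] at [th] along the segments
    starting there; comparing the directions [v] and [-v] gives equality. *)
Lemma psi_minimizer th : Theta th ->
  (forall th', Theta th' -> 0 <= psi c th' - psi c th - linear_form m (th' - th)) ->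
  expect_param c th = expect_vec q c.
Proof.
move=> Tth pmin.
have key v : linear_form m v <= linear_form (fun k => expect_param c th k 0) v.
  pose J : set R := `[0, 1]%classic.
  have J0 : J 0 by rewrite /J /= in_itv /= lexx ler01.
  have iJ : nondegenerate_interval J.
    split; first exact: interval_is_interval.
    by exists 0, 1; split => //; rewrite /J /= in_itv /= lexx ler01.
  have FP := within_dnbhs_proper iJ J0.
  pose g (s : R) : 'cV[R]_n := s *: v + th.
  have g0 : g 0 = th by rewrite /g scale0r add0r.
  have gd : is_deriv_on J g 0 v.
    have : (fun=> v) @ within J 0^' --> v by exact: cvg_cst.
    apply: cvg_trans; apply: near_eq_cvg.
    rewrite near_withinE; near=> s => _.
    have s0 : s != 0 by near: s; exact: nbhs_dnbhs_neq.
    by rewrite g0 /g addrK subr0 scalerA mulVf ?scale1r.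
  have dpsi : is_diff (g 0) (psi c) (linear_form (fun k => expect_param c th k 0)).
    by rewrite g0; exact: (is_diff_psi c_cont Theta_open Theta_norm Tth).
  have := is_deriv_on_comp dpsi gd; rewrite /is_deriv_on => H.
  apply: (cvgr_to_ge H); rewrite near_withinE; near=> s => Js.
  have s0 : s != 0 by near: s; exact: nbhs_dnbhs_neq.
  have sp : 0 < s by move: Js; rewrite /J /= in_itv /= => /andP[]; rewrite lt_neqAle eq_sym s0 => ->.
  have Ts : Theta (g s).
    near: s; apply: nbhs_dnbhs.
    have cg : {for 0, continuous g}.
      by apply: cvgD; [apply: cvgZr_tmp; exact: cvg_id|exact: cvg_cst].
    by apply: cg; rewrite g0; exact: open_nbhs_nbhs.
  have := pmin _ Ts; rewrite {2}/g addrK linearZ => P0.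
  rewrite subr0 -[leRHS]/(s^-1 * (psi c (g s) - psi c (g 0))) g0 ler_pdivlMl//.
  by rewrite -subr_ge0; exact: P0.
apply/matrixP => k j; rewrite (ord1 j).
have lk (L : 'I_n -> R) (e : R) : linear_form L (e *: delta_mx k 0) = e * L k.
  rewrite /linear_form (bigD1 k)//= big1 => [|i ik]; last first.
    by rewrite !mxE (negbTE ik) mulr0 mul0r.
  by rewrite !mxE !eqxx mulr1 addr0.
have := key (1 *: delta_mx k 0); have := key (-1 *: delta_mx k 0).
by rewrite !lk !mul1r !mulN1r lerN2 => h1 h2; apply/eqP; rewrite eq_le h1 h2.
Unshelve. all: by end_near. Qed.

Lemma KL_projectionP th : Theta th -> (KL q (dens c th) < +oo)%E ->
  is_KL_projection c Theta q (dens c th) <-> expect_param c th = expect_vec q c.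
Proof.
move=> Tth KLoo; split=> [[_ KLmin]|etaE].
  apply: psi_minimizer => // th' Tth'.
  rewrite -(KL_dens_le th' Tth KLoo).
  by apply: KLmin; exists th'.
split; first by exists th.
move=> _ [th' Tth' <-].
by rewrite (KL_dens_le th' Tth KLoo) subr_ge0 -etaE; exact: (psi_convex_ineq c_cont Theta_open Theta_norm).
Qed.

End KL_projection.

(** * Curves in the family and the projected field *)

Section curves_in_the_family.
Context {R : realType} {N n : nat} (c : 'cV[R]_N -> 'cV[R]_n) (Theta : set 'cV[R]_n).
Context (c_cont : forall k, continuous (fun x => c x k 0)).
Context (Theta_open : open Theta) (Theta_norm : normalizable c Theta).
Context (fisher_inv : forall th, Theta th -> fisher c th \in unitmx).
Context (J : set R) (theta : R -> 'cV[R]_n) (iJ : nondegenerate_interval J).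
Context (Ttheta : forall t, J t -> Theta (theta t)).
Context (t : R) (Jt : J t) (v : 'cV[R]_n) (dtheta : is_deriv_on J theta t v).

Lemma is_deriv_on_expect_param :
  is_deriv_on J (fun s => expect_param c (theta s)) t (fisher c (theta t) *m v).
Proof.
apply/is_deriv_on_cV => i.
have := is_deriv_on_comp (is_diff_mean c_cont Theta_open Theta_norm (Ttheta Jt) i) dtheta.
rewrite [X in is_deriv_on _ _ _ X -> _](_ : _ = (fisher c (theta t) *m v) i 0); last first.
  by rewrite mxE; apply: eq_bigr => k _; rewrite mulrC.
apply: eq_is_deriv_on => // s Js.
by rewrite (expect_param_moment c_cont Theta_open Theta_norm (Ttheta Js)).
Qed.

Lemma is_deriv_on_ln_dens x :
  is_deriv_on J (fun s => ln (dens c (theta s) x)) t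
    (dotc c v x - linear_form (fun k => expect_param c (theta t) k 0) v).
Proof.
have dl := is_diff_linear_form (fun k => c x k 0) (theta t).
have dp := is_diff_psi c_cont Theta_open Theta_norm (Ttheta Jt).
have := is_deriv_on_comp (is_diffB dl dp) dtheta.
rewrite [X in is_deriv_on _ _ _ X -> _](_ : _ =
  dotc c v x - linear_form (fun k => expect_param c (theta t) k 0) v); last first.
  by rewrite dotcE.
apply: eq_is_deriv_on => // s Js.
by rewrite ln_dens dotcE.
Qed.

(** The score [w . (c - eta)] determines [w], because the Fisher matrix is
    invertible. *)
Lemma is_deriv_on_ln_densP w :
  (forall x, is_deriv_on J (fun s => ln (dens c (theta s) x)) t
     (dotc c w x - linear_form (fun k => expect_param c (theta t) k 0) w)) <->
  v = w.
Proof.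
split=> [dw|<- x]; last exact: is_deriv_on_ln_dens.
apply/eqP; rewrite -subr_eq0; apply/eqP.
apply: (dotc_centered_inj c_cont Theta_open Theta_norm fisher_inv (Ttheta Jt)) => x.
have := is_deriv_on_unique iJ Jt (@is_deriv_on_ln_dens x) (dw x).
have lB (L : 'I_n -> R) : linear_form L (v - w) = linear_form L v - linear_form L w.
  exact: linearB.
rewrite dotcB lB.
move: (linear_form _ v) (linear_form _ w) (dotc c v x) (dotc c w x) => lv lw a b /= H; lra.
Qed.

End curves_in_the_family.

(** The quotient cancels against the density, leaving the pairing of [c_i] with
    the Fokker-Planck field; the product of means drops out because that field
    integrates to 0. *)
Lemma cov_score_dual {R : realType} {N n : nat} (c : 'cV[R]_N -> 'cV[R]_n)
    (Theta : set 'cV[R]_n) (c_cont : forall k, continuous (fun x => c x k 0))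
    (Theta_open : open Theta) (Theta_norm : normalizable c Theta)
    (f : 'cV[R]_N -> 'cV[R]_N) (a : 'cV[R]_N -> 'M[R]_N) th :
  Theta th -> dual_pair f a c (dens c th) ->
  \col_i cov (dens c th) (fun y => fokker_planck f a (dens c th) y / dens c th y)
    (fun y => c y i 0) = expect_vec (dens c th) (generator_vec f a c).
Proof.
move=> Tth [dual iFP FP0]; apply/matrixP => i j; rewrite (ord1 j) !mxE.
have [icFP igen dualE] := dual i.
set q := dens c th in iFP FP0 icFP igen dualE *.
have qn0 y : q y != 0 by rewrite gt_eqF// dens_gt0.
have Uq : (fun y => fokker_planck f a q y / q y * q y) = fokker_planck f a q.
  by apply/funext => y; rewrite divfK.
have Ucq : (fun y => fokker_planck f a q y / q y * c y i 0 * q y) =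
    (fun y => c y i 0 * fokker_planck f a q y).
  by apply/funext => y; rewrite mulrAC divfK// mulrC.
rewrite cov_expand.
- rewrite /expect Uq Ucq FP0 mul0r subr0 dualE; congr integ; apply/funext => y.
  by rewrite mxE mulrC.
- exact: (integrable_dens c_cont Theta_open Theta_norm Tth).
- exact: (integ_dens c_cont Theta_open Theta_norm Tth).
- by rewrite Uq.
- exact: (integrable_c_dens c_cont Theta_open Theta_norm Tth).
- by rewrite Ucq.
Qed.

Lemma density_normalized {R : realType} {d} {Om : measurableType d}
    (P : probability Om R) {N} (Y : Om -> 'cV[R]_N) (q : 'cV[R]_N -> R) :
  has_density P Y q ->
  [/\ forall x, 0 <= q x, leb_measurable q, leb_integrable q & integ q = 1].
Proof.
move=> [q0 mq qP]; have q1 : integ_ext q = 1%E.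
  by have := qP setT measurableT; rewrite preimage_setT probability_setT.
have iq : leb_integrable q.
  by apply: (ge0_leb_integrableP mq q0).2; rewrite q1 ltry.
split=> //; by move: q1; rewrite integ_extE// => -[].
Qed.

Theorem theorem6p5
  (R : realType) (d : measure_display) (Om : measurableType d)
  (P : probability Om R) (N M n : nat)
  (F : R -> set (set Om)) (W : R -> Om -> 'cV[R]_M)
  (f : R -> 'cV[R]_N -> 'cV[R]_N) (sigma : R -> 'cV[R]_N -> 'M[R]_(N, M))
  (X : R -> Om -> 'cV[R]_N) (p : R -> 'cV[R]_N -> R)
  (c : 'cV[R]_N -> 'cV[R]_n) (Theta : set 'cV[R]_n)
  (a : R -> 'cV[R]_N -> 'M[R]_N)
  (aE : forall t x, a t x = sigma t x *m (sigma t x)^T)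
  (filtF : filtration F)
  (bmW : brownian_motion P F W)
  (sdeX : ito_sde_solution P F W f sigma X)
  (X0_indep_W : independent P (generated_by [set 0] X) (generated_by nonneg W))
  (X0_dens : has_density P (X 0) (p 0))
  (p0_pos : {ae @lebN R N, forall x, 0 < p 0 (vec x)})
  (p0_moments : forall k : nat, (integ_ext (fun x => (norm2 x ^+ k * p 0 x)%R) < +oo)%E)
  (f_C1 : forall (t : R) i, 0 <= t -> Ck 1 (fun x => f t x i 0))
  (f_cont : forall x, {within nonneg, continuous (fun t => f t x)})
  (a_C2 : forall (t : R) i j, 0 <= t -> Ck 2 (fun x => a t x i j))
  (a_cont : forall x, {within nonneg, continuous (fun t => a t x)})
  (growth : exists2 K : R, 0 < K & forall (t : R) x, 0 <= t ->
     2 * (x^T *m f t x) 0 0 + opnorm (a t x) <= K * (1 + norm2 x ^+ 2))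
  (p_dens : forall t : R, 0 <= t -> has_density P (X t) (p t))
  (p_C2 : forall t : R, 0 <= t -> Ck 2 (p t))
  (p_C1 : forall x, C1_on nonneg (fun t => p t x))
  (p_pos : forall t : R, 0 <= t -> {ae @lebN R N, forall x, 0 < p t (vec x)})
  (p_FP : forall (t : R) x, 0 <= t ->
     is_deriv_on nonneg (fun s => p s x) t (fokker_planck (f t) (a t) (p t) x))
  (Theta_space : parameter_space c Theta)
  (fisher_inv : forall theta, Theta theta -> fisher c theta \in unitmx)
  (c_C2 : forall i, Ck 2 (fun x => c x i 0))
  (FP_L2 : forall theta (t : R), Theta theta -> 0 <= t ->
     (integ_ext (fun x =>
        ((fokker_planck (f t) (a t) (dens c theta) x / dens c theta x) ^+ 2 *
         dens c theta x)%R) < +oo)%E)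
  (dual_EF : forall theta (t : R), Theta theta -> 0 <= t ->
     dual_pair (f t) (a t) c (dens c theta))
  (dual_p : forall t : R, 0 <= t -> dual_pair (f t) (a t) c (p t))
  (p_c_fin : forall (t : R) i, 0 <= t -> leb_integrable (fun x => c x i 0 * p t x))
  (p_c_deriv : forall (t : R) i, 0 <= t ->
     is_deriv_on nonneg (fun s => expect (p s) (fun x => c x i 0)) t
       (integ (fun x => c x i 0 * deriv_on nonneg (fun s => p s x) t))) :
  [/\ forall (t : R) theta, 0 <= t -> Theta theta -> (KL (p t) (dens c theta) < +oo)%E ->
        (is_KL_projection c Theta (p t) (dens c theta) <->
         expect_param c theta = expect_vec (p t) c),
      forall t : R, 0 <= t ->
        is_deriv_on nonneg (fun s => expect_vec (p s) c) t
          (expect_vec (p t) (generator_vec (f t) (a t) c)) &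
      forall (J : set R) (theta etat : R -> 'cV[R]_n),
        nondegenerate_interval J -> J `<=` nonneg ->
        C1_on J theta -> (forall t, J t -> Theta (theta t)) ->
        (forall t, J t -> etat t = expect_param c (theta t)) ->
        ((forall t, J t -> is_deriv_on J etat t
            (expect_vec (dens_of_eta c Theta (etat t)) (generator_vec (f t) (a t) c)))
         <->
         (forall t, J t -> forall x,
            is_deriv_on J (fun s => ln (dens c (theta s) x)) t
              (tangent_proj c (theta t)
                 (fun y => fokker_planck (f t) (a t) (dens c (theta t)) y /
                           dens c (theta t) y) x)))
        /\
        ((forall t, J t -> is_deriv_on J etat t
            (expect_vec (dens_of_eta c Theta (etat t)) (generator_vec (f t) (a t) c)))
         <->
         (forall t, J t -> is_deriv_on J theta t
            (invmx (fisher c (theta t)) *m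
             expect_vec (dens c (theta t)) (generator_vec (f t) (a t) c))))].
Proof.
have [oTheta _ nTheta _] := Theta_space.
have c_cont k : continuous (fun x => c x k 0) by have [] := c_C2 k.
split.
- move=> t theta t0 Ttheta KLoo.
  have [q0 mq iq q1] := density_normalized (p_dens t t0).
  by apply: KL_projectionP => // k; exact: p_c_fin.
- have nonneg_itv : nondegenerate_interval (@nonneg R).
    split; last by exists 0, 1; rewrite /nonneg /= lexx ler01 ltr01.
    move=> x y x0 y0 z /andP[xz _]; exact: le_trans x0 xz.
  move=> t t0; apply/is_deriv_on_cV => k.
  have := p_c_deriv t k t0; rewrite [X in is_deriv_on _ _ _ X -> _](_ : _ =
    expect_vec (p t) (generator_vec (f t) (a t) c) k 0).
    by apply: eq_is_deriv_on => // s _; rewrite mxE.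
  have [dual _ _] := dual_p t t0; have [_ _ dualE] := dual k.
  rewrite mxE /expect; transitivity (integ (fun x => c x k 0 * fokker_planck (f t) (a t) (p t) x)).
    by congr integ; apply/funext => x; rewrite (is_deriv_onE nonneg_itv t0 (p_FP t x t0)).
  by rewrite dualE; congr integ; apply/funext => x; rewrite mxE mulrC.
move=> J theta etat iJ Jnonneg [dtheta dthetaP _] Ttheta etatE.
pose w t := invmx (fisher c (theta t)) *m
  expect_vec (dens c (theta t)) (generator_vec (f t) (a t) c).
have adaP t : J t -> is_deriv_on J etat t
    (expect_vec (dens_of_eta c Theta (etat t)) (generator_vec (f t) (a t) c)) <->
    dtheta t = w t.
  move=> Jt; have Tt := Ttheta t Jt; have dt := dthetaP t Jt.
  rewrite etatE// (dens_of_eta_expect_param c_cont oTheta nTheta fisher_inv)//.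
  have eta_deriv := is_deriv_on_expect_param c_cont oTheta nTheta Ttheta Jt dt.
  have etat_deriv : is_deriv_on J etat t (fisher c (theta t) *m dtheta t).
    by apply: eq_is_deriv_on eta_deriv => // s Js; rewrite etatE.
  split=> [/(is_deriv_on_unique iJ Jt etat_deriv) E|E].
    by rewrite /w -E mulKmx// fisher_inv.
  by move: etat_deriv; rewrite E /w mulKVmx// fisher_inv.
split; split=> H t Jt.
- move=> x; have Tt := Ttheta t Jt; have dt := dthetaP t Jt.
  have t0 := Jnonneg _ Jt.
  rewrite (tangent_projE c_cont oTheta nTheta)//=.
  rewrite (cov_score_dual c_cont oTheta nTheta Tt (dual_EF _ t Tt t0)) -/(w t).
  by rewrite -((adaP t Jt).1 (H t Jt)); exact: (is_deriv_on_ln_dens c_cont oTheta nTheta Ttheta Jt dt).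
- apply/(adaP t Jt).
  have Tt := Ttheta t Jt; have t0 := Jnonneg _ Jt.
  apply: (is_deriv_on_ln_densP c_cont oTheta nTheta fisher_inv iJ Ttheta Jt (dthetaP t Jt) _).1 => x.
  have := H t Jt x; rewrite (tangent_projE c_cont oTheta nTheta)//=.
  by rewrite (cov_score_dual c_cont oTheta nTheta Tt (dual_EF _ t Tt t0)).
- by rewrite -/(w t) -((adaP t Jt).1 (H t Jt)); exact: dthetaP.
- apply/(adaP t Jt); exact: (is_deriv_on_unique iJ Jt (dthetaP t Jt) (H t Jt)).
Qed.
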